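(* Let $K$ be a scattered linearly ordered compact space. Then $K\in\mathcal R$ if and only if $K$ has no cutting P-points.
   Context: All spaces are completely regular Hausdorff; maps are continuous; linearly ordered sets carry the order topology. A linearly ordered set is scattered if it does not contain an order isomorphic copy of the rationals $\mathbb Q$ (for compact linearly ordered spaces this is equivalent to being topologically scattered). A retraction is a map $f\colon X\to Y$ having a right inverse, i.e. a continuous $g\colon Y\to X$ with $fg=\mathrm{id}_Y$. An inverse sequence is an inverse system $\mathbb S=\langle X_\xi,p_\xi^\eta,\lambda\rangle$ indexed by an ordinal $\lambda$. It is continuous if for every limit ordinal $\delta<\lambda$ the space $X_\delta$ together with the maps $p_\xi^\delta$ ($\xi<\delta$) is the inverse limit of $\mathbb S\restriction\delta$. $\mathcal R$ is the smallest class of compact spaces which contains all metrizable compact spaces and is closed under limits of continuous inverse sequences whose bonding maps are retractions. A point $p$ of a space $Y$ is a P-point in $Y$ if $p$ is not isolated in $Y$ and for every sequence $\{u_n\}_{n\in\omega}$ of neighborhoods of $p$ we have $p\in\operatorname{int}(\bigcap_{n\in\omega}u_n)$. A point $p\in X$ is a cutting P-point in $X$ if there exist closed sets $A,B\subseteq X$ with $A\cup B=X$, $A\cap B=\{p\}$ and such that $p$ is a P-point both in the subspace $A$ and in the subspace $B$. *)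

(* Defs.v *)
From mathcomp Require Import all_boot all_order all_algebra.
From mathcomp Require Import all_classical all_reals.
From mathcomp Require Import topology.

Set Implicit Arguments.
Unset Strict Implicit.
Unset Printing Implicit Defensive.

Local Open Scope classical_set_scope.

Definition homeomorphic (X Y : topologicalType) : Prop :=
  exists (f : X -> Y) (g : Y -> X),
    [/\ continuous f, continuous g, cancel f g & cancel g f].

(* Any two real types are isomorphic, so the choice of R is immaterial. *)
Definition metrizable (R : realType) (X : topologicalType) : Prop :=
  exists M : metricType R, homeomorphic X M.

Definition retraction (X Y : topologicalType) (f : X -> Y) : Prop :=
  continuous f /\ exists2 g : Y -> X, continuous g & cancel g f.

(* Since [le i j] is a boolean equation, [bond] does not depend on the proof
   of [le i j] it is given. *)
Record inverse_system (I : Type) (le : rel I) := InverseSystem {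
  space :> I -> topologicalType;
  bond : forall i j : I, le i j -> space j -> space i;
  bond_continuous : forall (i j : I) (ij : le i j), continuous (bond ij);
  bond_id : forall (i : I) (ii : le i i) (x : space i), bond ii x = x;
  bond_comp : forall (i j k : I) (ij : le i j) (jk : le j k) (ik : le i k)
    (x : space k), bond ij (bond jk x) = bond ik x }.

Arguments bond {I le} _ {i j} _ _.

Definition threads (I : Type) (le : rel I) (S : inverse_system le) :
    set (prod_topology (fun i : I => S i)) :=
  [set x | forall (i j : I) (ij : le i j), bond S ij (x j) = x i].

Arguments threads {I le} S _.

Definition inverse_limit (I : Type) (le : rel I) (S : inverse_system le) :
  topologicalType := set_type (threads S).

(* Y is the limit of S with projections q: the q i are the coordinates of a
   homeomorphism from Y onto the space of threads. *)
Definition is_inverse_limit (I : Type) (le : rel I) (S : inverse_system le)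
    (Y : topologicalType) (q : forall i : I, Y -> S i) : Prop :=
  exists (f : Y -> inverse_limit S) (g : inverse_limit S -> Y),
    [/\ continuous f, continuous g, cancel f g, cancel g f
      & forall (y : Y) (i : I), set_val (f y) i = q i y].

(* Ordinals are represented by well-ordered types: the elements of I are the
   ordinals below lambda, with [le] their non-strict order. *)
Section inverse_sequence.
Variables (I : Type) (le : rel I).

Definition slt (i j : I) : bool := le i j && ~~ le j i.

Definition below (d : I) : Type := {i : I | slt i d}.

Definition below_le (d : I) : rel (below d) :=
  fun i j => le (sval i) (sval j).

Lemma slt_le (d : I) (i : below d) : le (sval i) d.
Proof. by case: i => i /= /andP[]. Qed.

Definition restr (S : inverse_system le) (d : I) :
    inverse_system (@below_le d) :=
  @InverseSystem (below d) (@below_le d)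
    (fun i => S (sval i))
    (fun i j ij => bond S ij)
    (fun i j ij => @bond_continuous I le S (sval i) (sval j) ij)
    (fun i ii => @bond_id I le S (sval i) ii)
    (fun i j k ij jk ik =>
       @bond_comp I le S (sval i) (sval j) (sval k) ij jk ik).

(* 0 is not a limit ordinal. *)
Definition limit_ordinal (d : I) : Prop :=
  (exists i : I, slt i d) /\
  (forall i : I, slt i d -> exists2 j : I, slt i j & slt j d).

Definition continuous_system (S : inverse_system le) : Prop :=
  forall d : I, limit_ordinal d ->
    @is_inverse_limit (below d) (@below_le d) (restr S d) (S d)
      (fun i => bond S (slt_le i)).

End inverse_sequence.

Inductive classR (R : realType) : topologicalType -> Prop :=
| classR_metrizable (X : topologicalType) :
    compact [set: X] -> metrizable R X -> classR R X
| classR_limit (I : Type) (le : rel I) (S : inverse_system le)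
    (X : topologicalType) :
    wochoice.well_order le ->
    continuous_system S ->
    (forall (i j : I) (ij : le i j), retraction (bond S ij)) ->
    (forall i : I, classR R (S i)) ->
    homeomorphic X (inverse_limit S) ->
    classR R X.

Definition P_point (Y : topologicalType) (p : Y) : Prop :=
  ~ isolated [set: Y] p /\
  forall u : nat -> set Y, (forall n, nbhs p (u n)) ->
    interior (\bigcap_n u n) p.

(* A and B, seen as types, carry the subspace topology. *)
Definition cutting_P_point (X : topologicalType) (p : X) : Prop :=
  exists A B : set X,
    [/\ closed A /\ closed B, A `|` B = [set: X], A `&` B = [set p],
        exists2 a : A, set_val a = p & P_point a
      & exists2 b : B, set_val b = p & P_point b].

Definition scattered_order (d : Order.disp_t) (K : orderType d) : Prop :=
  ~ exists f : rat -> K, {mono f : x y / (x <= y)%O}.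

(* Main.v *)
Require Import Defs.
From HB Require Import structures.
From mathcomp Require Import all_boot all_order all_algebra.
From mathcomp Require Import all_classical all_reals.
From mathcomp Require Import topology.

Set Implicit Arguments.
Unset Strict Implicit.
Unset Printing Implicit Defensive.

Import Order.TTheory GRing.Theory Num.Theory.

Local Open Scope classical_set_scope.

(* Spaces in R have no cutting P-points, by induction on R.  In the limit X of
   a continuous sequence of retractions, sections chosen at the successor steps
   embed every X_i in X coherently; let r_i be the resulting retraction of X
   onto X_i.  Let p be a cutting P-point of X = A `|` B.  If r_i maps no
   neighbourhood of p into A and none into B, then p is in X_i and is a cutting
   P-point there.  So, say, cofinally many r_i map a neighbourhood W_i of p
   into A.  If a countable set of such i is cofinal, the P-property gives x <> p
   in B that lies in all these W_i, so x = lim r_i x is in A.  Otherwise pick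
   i_0 < i_1 < ... with supremum d and x_n in X_(i_(n+1)), in W_(i_k) for k <= n
   and outside A: their cluster points are in X_d, in B and in A, hence equal
   p, whereas some W_j with j >= d contains no point of X_d outside A.

   Conversely, call a segment [x, y] absorbed if adding it to a disjoint closed
   set keeps the set in R (in a form stable under adding finite sets).
   Retracting onto initial parts of [x, y] shows that absorption passes to
   limits.  Absorbed segments [x, b] and [b, y] can be glued when b has
   countable cofinality on one side, since then one may retract onto
   [x, z_n] `|` [b, y] with jumps at z_n converging to b; and if b has
   uncountable cofinality on both sides, it is a cutting P-point.  Therefore
   "not hereditarily absorbed" would be a dense strict order, and a copy of the
   rationals would embed in K. *)

(** * Topological preliminaries *)

Lemma set_val_inj (T : Type) (A : set T) : injective (@set_val T A).
Proof. by move=> [x Ax] [y Ay] /= xy; apply: eq_sig_hprop. Qed.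

Lemma set_val_in (T : Type) (A : set T) (x : A) : A (set_val x).
Proof. exact: set_valP. Qed.

Lemma set_val_continuous (X : topologicalType) (A : set X) :
  continuous (@set_val X A).
Proof. exact: (@initial_continuous A X set_val). Qed.

Lemma continuous_set_type (X Y : topologicalType) (A : set X) (f : Y -> A) :
  continuous (fun y => set_val (f y)) -> continuous f.
Proof. exact: (@continuous_comp_initial A Y X set_val f). Qed.

Lemma continuous_prod_topology (I : Type) (K : I -> topologicalType)
    (Y : topologicalType) (f : Y -> prod_topology K) :
  (forall i, continuous (fun y => f y i)) -> continuous f.
Proof.
move=> cf y.
apply/cvg_sup => i U [V [[O oO <-] /= Oy] VU].
have yO : nbhs y ((fun z => f z i) @^-1` O).
  by apply: cf; exact: open_nbhs_nbhs.
by apply: filterS yO => z Oz; exact: VU.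
Qed.

Lemma coord_continuous (I : Type) (K : I -> topologicalType) (i : I) :
  continuous (fun x : prod_topology K => x i).
Proof. exact: (@proj_continuous {classic I} K i). Qed.

Lemma continuous_closed_preimage (X Y : topologicalType) (f : X -> Y)
    (D : set Y) : continuous f -> closed D -> closed (f @^-1` D).
Proof. by move=> /continuous_closedP; apply. Qed.

Lemma comp_continuous (X Y Z : topologicalType) (f : X -> Y) (g : Y -> Z) :
  continuous f -> continuous g -> continuous (fun x => g (f x)).
Proof. by move=> cf cg x; apply: continuous_comp; [exact: cf|exact: cg]. Qed.

Lemma hausdorff_inj (X Y : topologicalType) (f : X -> Y) :
  continuous f -> injective f -> hausdorff_space Y -> hausdorff_space X.
Proof.
move=> cf fi hY x y xy; apply/fi/hY => U V Ux Vy.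
by have [z [/= Uz Vz]] := xy _ _ (cf _ _ Ux) (cf _ _ Vy); exists (f z).
Qed.

Lemma hausdorff_set_type (X : topologicalType) (A : set X) :
  hausdorff_space X -> hausdorff_space A.
Proof.
exact: (hausdorff_inj (@set_val_continuous X A) (@set_val_inj _ A)).
Qed.

Lemma hausdorff_prod_topology (I : Type) (K : I -> topologicalType) :
  (forall i, hausdorff_space (K i)) -> hausdorff_space (prod_topology K).
Proof. exact: (@hausdorff_product {classic I} K). Qed.

Lemma compact_prod_topology (I : Type) (K : I -> topologicalType) :
  (forall i, compact [set: K i]) -> compact [set: prod_topology K].
Proof.
move=> /(@tychonoff {classic I} K); rewrite (_ : [set f | _] = setT) //.
by apply/seteqP; split.
Qed.

Lemma compact_image (X Y : topologicalType) (f : X -> Y) (A : set X) :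
  continuous f -> compact A -> compact (f @` A).
Proof.
by move=> cf; apply: continuous_compact; apply: continuous_subspaceT.
Qed.

Lemma compact_set_type (X : topologicalType) (A : set X) :
  compact A -> compact [set: A].
Proof.
move=> cA F FF _.
have [x [Ax Fx]] : (A `&` cluster (set_val @ F)) !=set0.
  by apply: cA; apply: nearW => x; exact: set_val_in.
exists (SigSub (mem_set Ax)); split => // U V FU [W [[O oO <-] /= Ox] OV].
have [||z [/= [u Uu <-] Oz]] := Fx (@set_val X A @` U) O.
- by apply: (@filterS _ F _ U) FU => u Uu; exists u.
- exact: open_nbhs_nbhs.
- by exists u; split => //; apply: OV.
Qed.

Lemma closed_equalizer (X Y : topologicalType) (f g : X -> Y) :
  hausdorff_space Y -> continuous f -> continuous g ->
  closed [set x | f x = g x].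
Proof.
move=> hY cf cg x xcl; apply: hY => U V Ux Vx.
have [|z [/= fgz [Uz Vz]]] := xcl (f @^-1` U `&` g @^-1` V).
  by apply: filterI; [exact: cf|exact: cg].
by exists (f z); split => //; rewrite fgz.
Qed.

(** The preimage of a closed [D] under [e] is the image under [g] of the compact intersection of [D]
    and [C], hence closed. A closed description of the range of [e] thus yields continuity. *)
Lemma section_continuous (X Y : topologicalType) (C : set X) (g : X -> Y)
    (e : Y -> X) :
  compact [set: X] -> hausdorff_space Y -> closed C -> continuous g ->
  (forall y, C (e y)) -> cancel e g -> (forall x, C x -> e (g x) = x) ->
  continuous e.
Proof.
move=> cX hY clC cg Ce eg ge; apply/continuous_closedP => D clD.
rewrite (_ : e @^-1` D = g @` (D `&` C)); last first.
  apply/seteqP; split => [y Dy|_ [x [Dx Cx] <-]] /=; last by rewrite ge.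
  by exists (e y).
apply: (compact_closed hY); apply: compact_image => //.
by apply: subclosed_compact cX _ => //; exact: closedI.
Qed.

(* [x] is a cluster point of the net [z] over the directed set [D]. *)
Lemma net_cluster (X : topologicalType) (K : set X) (I : Type) (D : set I)
    (le : rel I) (z : I -> X) :
  compact K -> (forall i, D i -> K (z i)) -> D !=set0 ->
  (forall i, D i -> le i i) ->
  (forall i j, D i -> D j -> exists k, [/\ D k, le i k & le j k]) ->
  (forall i j k, D i -> D j -> D k -> le i j -> le j k -> le i k) ->
  exists2 x, K x & forall i C, D i -> closed C ->
    (forall j, D j -> le i j -> C (z j)) -> C x.
Proof.
move=> cK zK [i0 Di0] lexx ledir letr.
pose B i := z @` [set j | D j /\ le i j].
have FF : ProperFilter (filter_from D B).
  apply: filter_from_proper.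
    apply: filter_from_filter; first by exists i0.
    move=> i j Di Dj; have [k [Dk ik jk]] := ledir _ _ Di Dj; exists k => //.
    by move=> _ [l [Dl kl] <-]; split; exists l => //; split => //;
      apply: letr kl.
  by move=> i Di; exists (z i), i => //; split => //; exact: lexx.
have [x [Kx Fx]] : (K `&` cluster (filter_from D B)) !=set0.
  by apply: cK; exists i0 => // _ [j [Dj _] <-]; exact: zK.
exists x => // i C Di clC Cz; apply: clC => U Ux.
have [||y [[j [Dj ij] <-] Uj]] := Fx (B i) U.
- by exists i.
- by [].
by exists (z j); split => //; exact: Cz.
Qed.

Lemma homeomorphic_sym (X Y : topologicalType) :
  homeomorphic X Y -> homeomorphic Y X.
Proof. by move=> [f [g [cf cg fK gK]]]; exists g, f. Qed.

Lemma homeomorphic_trans (X Y Z : topologicalType) :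
  homeomorphic X Y -> homeomorphic Y Z -> homeomorphic X Z.
Proof.
move=> [f [g [cf cg fK gK]]] [f' [g' [cf' cg' fK' gK']]].
exists (fun x => f' (f x)), (fun z => g (g' z)); split.
- exact: comp_continuous cf cf'.
- exact: comp_continuous cg' cg.
- by move=> x; rewrite fK' fK.
- by move=> x; rewrite gK gK'.
Qed.

Lemma homeomorphic_compact (X Y : topologicalType) :
  homeomorphic X Y -> compact [set: X] -> compact [set: Y].
Proof.
move=> [f [g [cf cg fK gK]]] /(compact_image cf).
rewrite (_ : f @` setT = setT) //; apply/seteqP; split => // y _.
by exists (g y).
Qed.

Lemma homeomorphic_hausdorff (X Y : topologicalType) :
  homeomorphic X Y -> hausdorff_space X -> hausdorff_space Y.
Proof.
by move=> [f [g [cf cg fK gK]]]; exact: (hausdorff_inj cg (can_inj gK)).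
Qed.

Lemma compact_bijection_homeomorphic (X Y : topologicalType) (f : X -> Y) :
  compact [set: X] -> hausdorff_space Y -> continuous f -> injective f ->
  (forall y, exists x, f x = y) ->
  exists2 g, continuous g & cancel f g /\ cancel g f.
Proof.
move=> cX hY cf fi /choice[g gK]; exists g; last by split => // x; exact/fi.
by apply: (section_continuous (C := setT)) cf _ _ _ => // x _; exact/fi.
Qed.

(** * P-points of subspaces *)

(** P-points of the subspace [C], phrased with neighbourhoods in the whole space to avoid subtypes.
    Membership of [p] in [C] is not included; for cutting points it comes from the equation for the
    intersection of [A] and [B]. *)
Definition P_in (X : topologicalType) (C : set X) (p : X) : Prop :=
  (forall U, nbhs p U -> exists x, [/\ U x, C x & x <> p]) /\
  (forall u : nat -> set X, (forall n, nbhs p (u n)) ->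
     exists2 V, nbhs p V & V `&` C `<=` \bigcap_n u n).

Lemma nbhs_set_type (X : topologicalType) (C : set X) (c : C) (V : set C) :
  nbhs c V <-> exists2 U, nbhs (set_val c) U & set_val @^-1` U `<=` V.
Proof.
split=> [[W [[O oO <-] /= Oc] OV]|[U cU UV]].
  by exists O => //; exact: open_nbhs_nbhs.
by apply: filterS UV _; exact: set_val_continuous.
Qed.

Lemma P_point_set_type (X : topologicalType) (C : set X) (c : C) :
  P_point c <-> P_in C (set_val c).
Proof.
split=> [[niso Pc]|[niso Pc]]; split.
- move=> U cU; apply: contrapT => nU; apply: niso; split; first exact/mem_set.
  exists (set_val @^-1` U); first exact: set_val_continuous.
  apply/seteqP; split => [x [Ux _]|_ ->] /=; last first.
    by split => //; exact: nbhs_singleton cU.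
  apply: contrapT => xc; apply: nU; exists (set_val x); split => //.
    exact: set_val_in.
  by move=> /set_val_inj.
- move=> u cu.
  have [n|V cV VU] := (nbhs_set_type c _).1 (Pc (fun n => set_val @^-1` u n) _).
    exact: set_val_continuous.
  exists V => // x [Vx Cx] n _.
  exact: (VU (SigSub (mem_set Cx))).
- move=> [_ [V /nbhs_set_type[U cU UV] Vc]].
  have [x [Ux Cx xc]] := niso _ cU; apply: xc.
  pose x' : C := SigSub (mem_set Cx).
  have : [set c] x' by rewrite -Vc; split => //; exact: UV.
  by move=> /= <-.
- move=> u cu.
  have /choice[v uv] n : exists U, nbhs (set_val c) U /\ set_val @^-1` U `<=` u n.
    by have [U cU Uu] := (nbhs_set_type c _).1 (cu n); exists U.
  have [V cV VU] := Pc v (fun n => (uv n).1).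
  apply/nbhs_set_type; exists V => // x Vx n _.
  by apply: (uv n).2; apply: VU => //; split => //; exact: set_val_in.
Qed.

Lemma cutting_P_pointP (X : topologicalType) (p : X) :
  cutting_P_point p <-> exists A B : set X,
    [/\ closed A /\ closed B, A `|` B = [set: X], A `&` B = [set p],
        P_in A p & P_in B p].
Proof.
split=> -[A [B [clAB AB ABp]]].
  move=> [a ap /P_point_set_type Pa] [b bp /P_point_set_type Pb]; exists A, B.
  by split => //; [rewrite -ap|rewrite -bp].
move=> PA PB; exists A, B.
have [Ap Bp] : (A `&` B) p by rewrite ABp.
split => //; [exists (SigSub (mem_set Ap))|exists (SigSub (mem_set Bp))] => //.
  exact/P_point_set_type.
exact/P_point_set_type.
Qed.

(** The balls of radius [1/(n+1)] about [p] have only [p] in common, whereas the P-property puts a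
    neighbourhood of [p] in [A], which has other points, inside all of them. *)
Lemma metrizable_no_cutting_P_point (R : realType) (X : topologicalType)
  (p : X) : metrizable R X -> ~ cutting_P_point p.
Proof.
move=> [M [f [g [cf cg fK gK]]]] /cutting_P_pointP[A [_ [_ _ _ [niso PA] _]]].
pose u n := f @^-1` ball (f p) (n.+1%:R^-1 : R)%R.
have [n|V pV VU] := PA u.
  by apply: cf; apply: nbhsx_ballx; rewrite invr_gt0 ltr0n.
have [x [Vx Ax xp]] := niso _ pV; apply: xp; apply: (can_inj fK).
apply: contrapT => /eqP; rewrite eq_sym -mdist_gt0 => dgt0.
have [n] := ltr_add_invr dgt0; rewrite add0r => nd.
have := VU x (conj Vx Ax) n I.
by rewrite /u /= ballEmdist /= => /lt_trans/(_ nd); rewrite ltxx.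
Qed.

(** * Well-orders and limits of retractions *)

Section well_order.
Variables (I : Type) (le : rel I).
Hypothesis wo : wochoice.well_order le.

(** A well-order is given only by unique minima of nonempty predicates; totality, antisymmetry and
    transitivity are read off below from sets of two or three elements. *)
Lemma wo_min_unique (P : set I) : P !=set0 ->
  exists m, [/\ P m, forall x, P x -> le m x &
    forall y, P y -> (forall x, P x -> le y x) -> m = y].
Proof.
move=> [x Px]; pose A : pred I := fun z => `[< P z >].
have [|m [[Pm mP] mU]] := @wo A; first by exists x; apply/asboolP.
exists m; split; first exact/asboolP.
- by move=> y Py; apply: mP; apply/asboolP.
- move=> y Py yP; apply: mU; split; first exact/asboolP.
  by move=> z /asboolP; exact: yP.
Qed.

Lemma wo_min (P : set I) : P !=set0 -> exists2 m, P m & forall x, P x -> le m x.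
Proof. by move=> /wo_min_unique[m [Pm mP _]]; exists m. Qed.

Lemma wo_total (x y : I) : le x y \/ le y x.
Proof.
have [|m mxy mP] := @wo_min [set z | z = x \/ z = y]; first by exists x; left.
by case: mxy => mE; move: mP; rewrite mE => mP; [left|right]; apply: mP;
  [right|left].
Qed.

Lemma wo_refl (x : I) : le x x.
Proof. by case: (wo_total x x). Qed.

Lemma wo_anti (x y : I) : le x y -> le y x -> x = y.
Proof.
move=> xy yx; have [|m [_ _ mU]] := @wo_min_unique [set z | z = x \/ z = y].
  by exists x; left.
rewrite -(mU x) ?(mU y) //.
- by right.
- by move=> z [] ->; rewrite ?wo_refl.
- by left.
- by move=> z [] ->; rewrite ?wo_refl.
Qed.

Lemma wo_trans (x y z : I) : le x y -> le y z -> le x z.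
Proof.
move=> xy yz; have [|m mxyz mP] := @wo_min [set t | [\/ t = x, t = y | t = z]].
  by exists x; apply: Or31.
have mx : le m x by apply: mP; apply: Or31.
have my : le m y by apply: mP; apply: Or32.
have mz : le m z by apply: mP; apply: Or33.
case: mxyz => mE; first by rewrite -mE.
  by rewrite (wo_anti xy) // -mE.
by rewrite -(wo_anti yz) // -mE.
Qed.

Lemma sltP (x y : I) : slt le x y <-> ~ le y x.
Proof.
rewrite /slt; split => [/andP[_ /negP]|yx] //.
by apply/andP; split; [case: (wo_total x y)|exact/negP].
Qed.

Lemma slt_leW (x y : I) : slt le x y -> le x y.
Proof. by move=> /andP[]. Qed.

Lemma slt_le_trans (x y z : I) : slt le x y -> le y z -> slt le x z.
Proof.
move=> /sltP yx yz; apply/sltP => zx; apply: yx; exact: wo_trans zx.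
Qed.

Lemma le_slt_trans (x y z : I) : le x y -> slt le y z -> slt le x z.
Proof.
move=> xy /sltP yz; apply/sltP => zx; apply: yz; exact: wo_trans xy.
Qed.

Lemma wo_ind (P : I -> Prop) :
  (forall x, (forall y, slt le y x -> P y) -> P x) -> forall x, P x.
Proof.
move=> IH x; apply: contrapT => nPx.
have [|m nPm mP] := @wo_min [set y | ~ P y]; first by exists x.
apply: nPm; apply: IH => y /sltP ym; apply: contrapT => nPy; apply: ym.
exact: mP.
Qed.

Lemma wo_upper2 (i j : I) : exists k, le i k /\ le j k.
Proof.
by case: (wo_total i j) => ij; [exists j|exists i]; split => //; exact: wo_refl.
Qed.

End well_order.

(** * Sequences of retractions of one compact space, and P-points *)

Section retraction_sequence.
Variables (X : topologicalType) (I : Type) (le : rel I) (r : I -> X -> X).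
Hypotheses (wo : wochoice.well_order le)
  (cX : compact [set: X]) (hX : hausdorff_space X)
  (cr : forall i, continuous (r i))
  (r_le : forall i j x, le i j -> r i (r j x) = r i x)
  (r_ge : forall i j x, le i j -> r j (r i x) = r i x)
  (r_limit : forall d x y, limit_ordinal le d -> r d y = y ->
     (forall i, slt le i d -> r i y = r i x) -> y = r d x)
  (r_total : forall x y, (forall i, r i y = r i x) -> y = x).

(** [y] is a cluster point of the net [r j x], [j] in [D]. By [r_le], [r i] is constant along the
    net from [j] on; by [r_ge], [r d] fixes all its terms. Both conditions are closed. *)
Lemma retractions_cluster (D : set I) (C : set X) (x : X) :
  closed C -> D !=set0 -> (forall j, D j -> C (r j x)) ->
  exists y, [/\ C y, forall i j, D j -> le i j -> r i y = r i x &
    forall d, (forall j, D j -> le j d) -> r d y = y].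
Proof.
move=> clC D0 Cr.
have [||||y _ yD] := @net_cluster _ setT _ D le (fun j => r j x) cX _ D0.
- by [].
- by move=> i _; exact: wo_refl.
- move=> i j Di Dj; case: (wo_total wo i j) => ij.
    by exists j; split => //; exact: wo_refl.
  by exists i; split => //; exact: wo_refl.
- by move=> i j k _ _ _; exact: wo_trans.
have [j0 Dj0] := D0.
exists y; split.
- by apply: (yD j0) => // j Dj _; exact: Cr.
- move=> i j Dj ij; apply: (yD j [set z | r i z = r i x]) => //.
    by apply: closed_equalizer => // z; exact: cvg_cst.
  by move=> k Dk jk /=; rewrite r_le //; exact: wo_trans jk.
- move=> d Dd; apply: (yD j0 [set z | r d z = z]) => //.
    by apply: closed_equalizer => // z; exact: cvg_id.
  by move=> k Dk _ /=; rewrite r_ge //; exact: Dd.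
Qed.

(** [r_limit] identifies a cluster point of the terms [r j x] that lie in [C] with [r d x]. *)
Lemma closed_retraction_limit (C : set X) (d : I) (x : X) :
  closed C -> limit_ordinal le d ->
  (forall i, slt le i d -> exists j, [/\ le i j, slt le j d & C (r j x)]) ->
  C (r d x).
Proof.
move=> clC dlim dC; pose D := [set j | slt le j d /\ C (r j x)].
have [||y [Cy yx yd]] := @retractions_cluster D C x clC.
- by have [[i ltid] _] := dlim; have [j [_ jd Cj]] := dC i ltid; exists j.
- by move=> j [].
rewrite -(r_limit dlim (y := y)) //.
  by apply: yd => j [jd _]; exact: slt_leW.
by move=> i /dC[j [ij jd Cj]]; apply: yx ij.
Qed.

Lemma closed_retraction_total (C : set X) (i0 : I) (x : X) :
  closed C -> (forall i, exists2 j, le i j & C (r j x)) -> C x.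
Proof.
move=> clC xC; pose D := [set j | C (r j x)].
have [|| y [Cy yx _]] := @retractions_cluster D C x clC.
- by have [j _ Cj] := xC i0; exists j.
- by move=> j.
have <- : y = x by apply: r_total => i; have [j ij Cj] := xC i; apply: yx ij.
by [].
Qed.

Lemma lub_limit_ordinal (s : nat -> I) (d : I) :
  (forall n, slt le (s n) (s n.+1)) -> (forall n, le (s n) d) ->
  (forall i, (forall n, le (s n) i) -> le d i) ->
  (forall i, slt le i d -> exists n, le i (s n)) /\ limit_ordinal le d.
Proof.
move=> sS sd dmin.
have lts n : slt le (s n) d by apply: slt_le_trans (sS n) _.
have cofs i : slt le i d -> exists n, le i (s n).
  move=> /(sltP wo) di; apply: contrapT => ni; apply: di; apply: dmin => n.
  by case: (wo_total wo (s n) i) => // ?; case: ni; exists n.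
split => //; split; first by exists (s 0%N).
move=> i /cofs[n isn]; exists (s n.+1) => //.
exact: le_slt_trans isn (sS n).
Qed.

Lemma slt_sequence_mono (s : nat -> I) :
  (forall n, slt le (s n) (s n.+1)) ->
  forall m n, (m <= n)%N -> le (s m) (s n).
Proof.
move=> sS m; elim=> [|n IH]; first by rewrite leqn0 => /eqP->; exact: (wo_refl wo).
rewrite leq_eqVlt ltnS => /predU1P[->|/IH smn]; first exact: (wo_refl wo).
by apply: (wo_trans wo) smn _; exact: slt_leW.
Qed.

Variables (p : X) (A B : set X).
Hypotheses (clA : closed A) (clB : closed B) (AB : A `|` B = [set: X])
  (ABp : A `&` B = [set p]) (PB : P_in B p).

Let mapped_to_A j := exists2 W, open_nbhs p W & forall x, W x -> A (r j x).

Let notA (x : X) : B x -> x <> p -> ~ A x.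
Proof. by move=> Bx xp Ax; have : (A `&` B) x by []; rewrite ABp. Qed.

Let notA_B (x : X) : ~ A x -> B x.
Proof. by move=> nAx; have [] : (A `|` B) x by rewrite AB. Qed.

Let countable_cofinality (s : nat -> I) :
  (forall i, exists2 j, le i j & mapped_to_A j) ->
  ~ forall i, exists n, le i (s n).
Proof.
move=> cofA cofs.
have /choice[t tP] n : exists t : I * set X,
    [/\ le (s n) t.1, open_nbhs p t.2 & forall x, t.2 x -> A (r t.1 x)].
  by have [j sj [W pW WA]] := cofA (s n); exists (j, W).
have [niso Pp] := PB.
have [n|V pV VW] := Pp (fun n => (t n).2).
  by apply: open_nbhs_nbhs; have [] := tP n.
(* [x] lies in every chosen neighbourhood, so cofinally many [r j x] are in the closed set [A], and
   with them their limit [x]. *)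
have [x [Vx Bx xp]] := niso _ pV; apply: (notA Bx xp).
apply: (closed_retraction_total (s 0%N)) => // i.
have [n isn] := cofs i; have [sn _ WA] := tP n.
exists (t n).1; first exact: wo_trans sn.
by apply: WA; exact: VW.
Qed.

Let uncountable_cofinality :
  (forall i, exists2 j, le i j & mapped_to_A j) -> I ->
  ~ forall s : nat -> I, exists i, forall n, slt le (s n) i.
Proof.
move=> cofA i0 unb.
(* States of the recursion: an index and an open neighbourhood of [p] that is mapped into [A]. A
   step also provides a point of the old neighbourhood outside [A] that the new retraction fixes. *)
pose good (t : I * set X) := open_nbhs p t.2 /\ forall x, t.2 x -> A (r t.1 x).
pose R (t t' : {t | good t}) := [/\ slt le (sval t).1 (sval t').1,
  (sval t').2 `<=` (sval t).2 &
  exists x, [/\ (sval t).2 x, ~ A x & r (sval t').1 x = x]].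
have step t : {t' | R t t'}.
  apply: cid; case: t => -[i W] [/= pW WA].
  have [x [Wx Bx xp]] := PB.1 _ (open_nbhs_nbhs pW).
  have nAx := notA Bx xp.
  (* [W] minus [A] is an open neighbourhood of [x], the limit of the [r j x], so these lie in it
     from some index on. *)
  have [j0 j0P] : exists j0, forall j, le j0 j -> W (r j x) /\ ~ A (r j x).
    apply: contrapT => nj0.
    suff : (~` (W `&` ~` A)) x by apply; split.
    apply: (closed_retraction_total i0).
      by apply: open_closedC; apply: openI; [case: pW|exact: closed_openC].
    move=> j; apply: contrapT => nj; apply: nj0; exists j => k jk.
    by apply: contrapT => nk; apply: nj; exists k.
  have [i1 i1P] := unb (fun _ => i).
  have [i2 [i12 j02]] := wo_upper2 wo i1 j0.
  have [i' i2i' [W' pW' WA']] := cofA i2.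
  have gt' : good (i', W `&` W').
    split=> /= [|y [_]]; last exact: WA'.
    by split; [apply: openI; [case: pW|case: pW']
              |split; [case: pW|case: pW']].
  exists (exist _ (i', W `&` W') gt'); split => //=.
    by apply: slt_le_trans (i1P 0%N) _ => //; exact: wo_trans i12 i2i'.
  have [Wx' nAx'] := j0P i' (wo_trans wo j02 i2i').
  by exists (r i' x); split => //; rewrite r_ge //; exact: wo_refl.
have [j0 _ [W0 pW0 WA0]] := cofA i0.
have gt0 : good (j0, W0) by [].
have [t [_ tR]] := dependent_choice step (exist _ (j0, W0) gt0).
pose s n := (sval (t n)).1; pose W n := (sval (t n)).2.
have sS n : slt le (s n) (s n.+1) by have [] := tR n.
have smono := slt_sequence_mono sS.
have Wmono m n : (m <= n)%N -> W n `<=` W m.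
  elim: n => [|n IH]; first by rewrite leqn0 => /eqP->.
  rewrite leq_eqVlt ltnS => /predU1P[->//|/IH WmW] y Wy; apply: WmW.
  by have [_ + _] := tR n; apply.
have WA n y : W n y -> A (r (s n) y) by have [_] := svalP (t n); apply.
have /choice[x xP] n : exists x, [/\ W n x, ~ A x & r (s n.+1) x = x].
  by have [] := tR n.
have [d sd dmin] : exists2 d, (forall n, le (s n) d) &
    forall i, (forall n, le (s n) i) -> le d i.
  have [|d dP dmin] := @wo_min _ _ wo [set i | forall n, le (s n) i].
    by have [i iP] := unb s; exists i => n; exact/slt_leW/iP.
  by exists d.
have [cofs dlim] := lub_limit_ordinal sS sd dmin.
have [||||y _ yP] :=
    @net_cluster _ setT nat setT (fun m n => (m <= n)%N) x cX _ (ex_intro _ 0%N Logic.I).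
- by [].
- by move=> n _; exact: leqnn.
- by move=> m n _ _; exists (maxn m n); rewrite leq_maxl leq_maxr.
- by move=> m n k _ _ _; exact: leq_trans.
have ydy : r d y = y.
  apply: (yP 0%N [set z | r d z = z]) => //.
    by apply: closed_equalizer => // z; exact: cvg_id.
  by move=> n _ _ /=; have [_ _ <-] := xP n; rewrite r_ge.
(* For [m >= n] the point [x m] is in [W n], so [r (s n)] sends it into [A]. This passes to the
   cluster point [y], and then to [r d y] at the supremum [d]. *)
have Ay : A y.
  rewrite -ydy; apply: closed_retraction_limit => // i /cofs[n isn].
  exists (s n); split => //; first by exact: slt_le_trans (sS n) (sd _).
  apply: (yP n (r (s n) @^-1` A)) => //; first exact: continuous_closed_preimage.
  by move=> m _ nm /=; apply: WA; apply: (Wmono _ _ nm); have [] := xP m.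
have By : B y.
  by apply: (yP 0%N) => // n _ _; apply: notA_B; have [] := xP n.
have {ydy Ay By} yp : y = p.
  by have : (A `&` B) y by []; rewrite ABp.
(* As [j] is above [d], [r j] fixes every [x n]. Since [x n] is not in [A], it is not in [U], and so
   neither is the cluster point [p]. *)
have [j dj [U pU UA]] := cofA d.
suff : (~` U) y by apply; rewrite yp; case: pU.
apply: (yP 0%N) => //; first by apply: open_closedC; case: pU.
move=> n _ _ Ux; have [_ nAx xx] := xP n; apply: nAx.
by rewrite -xx -(@r_ge _ j) ?xx; [exact: UA|exact: wo_trans (sd _) dj].
Qed.

(** A sequence without a strict upper bound is cofinal, so the two preceding cases are
    exhaustive. *)
Lemma not_cofinally_mapped :
  I -> ~ forall i, exists2 j, le i j & mapped_to_A j.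
Proof.
move=> i0 cofA; apply: (uncountable_cofinality cofA i0) => s.
apply: contrapT => ns; apply: (@countable_cofinality s cofA) => i.
apply: contrapT => ni; apply: ns; exists i => n.
by apply/(sltP wo) => isn; apply: ni; exists n.
Qed.

End retraction_sequence.

Lemma P_in_section (X Y : topologicalType) (g : X -> Y) (e : Y -> X)
    (C : set X) (p : X) :
  continuous g -> continuous e -> cancel e g -> e (g p) = p -> P_in C p ->
  (forall W, nbhs p W -> exists x, [/\ W x, C (e (g x)) & e (g x) <> p]) ->
  P_in (e @^-1` C) (g p).
Proof.
move=> cg ce eg egp [_ PC] niso; split.
  move=> U gpU; have [|x [Ux Cx xp]] := niso (g @^-1` U); first exact: cg.
  by exists (g x); split => // gxp; apply: xp; rewrite gxp.
move=> u gpu; have [n|V pV VC] := PC (fun n => g @^-1` u n); first exact: cg.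
exists (e @^-1` V); first by apply: ce; rewrite egp.
by move=> y [Vy Cy] n _; have := VC (e y) (conj Vy Cy) n Logic.I; rewrite /= eg.
Qed.

(** Arbitrarily close to [p] there are points whose image under [e] after [g] is outside [B], hence
    in [A], and likewise with [A] and [B] exchanged. So [e (g p)] is in both closed sets and equals
    [p], and these images show that [g p] is isolated on neither side. *)
Lemma cutting_P_point_section (X Y : topologicalType) (g : X -> Y) (e : Y -> X)
    (A B : set X) (p : X) :
  continuous g -> continuous e -> cancel e g ->
  closed A -> closed B -> A `|` B = [set: X] -> A `&` B = [set p] ->
  P_in A p -> P_in B p ->
  ~ (exists2 W, open_nbhs p W & forall x, W x -> A (e (g x))) ->
  ~ (exists2 W, open_nbhs p W & forall x, W x -> B (e (g x))) ->
  cutting_P_point (g p).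
Proof.
move=> cg ce eg clA clB AB ABp PA PB nA nB.
have cr : continuous (fun x => e (g x)) := comp_continuous cg ce.
have not_mapped C : ~ (exists2 W, open_nbhs p W & forall x, W x -> C (e (g x))) ->
    forall W, nbhs p W -> exists2 x, W x & ~ C (e (g x)).
  move=> nC W; rewrite nbhsE => -[O pO OW]; apply: contrapT => nx; apply: nC.
  exists O => // x Ox; apply: contrapT => nCx; apply: nx; exists x => //.
  exact: OW.
have [Ap Bp] : (A `&` B) p by rewrite ABp.
have AorB x : A x \/ B x by have : (A `|` B) x by rewrite AB.
have egp : e (g p) = p.
  have : (A `&` B) (e (g p)); last by rewrite ABp.
  split.
    apply: clA => U /cr /(not_mapped _ nB)[x Ux nBx]; exists (e (g x)).
    by case: (AorB (e (g x))).
  apply: clB => U /cr /(not_mapped _ nA)[x Ux nAx]; exists (e (g x)).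
  by case: (AorB (e (g x))).
apply/cutting_P_pointP; exists (e @^-1` A), (e @^-1` B); split.
- by split; exact: continuous_closed_preimage.
- by rewrite -preimage_setU AB preimage_setT.
- rewrite -preimage_setI ABp; apply/seteqP; split => [y /= yp|y ->] //=.
  by rewrite -yp eg.
- apply: P_in_section => // W /(not_mapped _ nB)[x Wx nBx]; exists x; split => //.
    by case: (AorB (e (g x))).
  by move=> xp; apply: nBx; rewrite xp.
- apply: P_in_section => // W /(not_mapped _ nA)[x Wx nAx]; exists x; split => //.
    by case: (AorB (e (g x))).
  by move=> xp; apply: nAx; rewrite xp.
Qed.

Section inverse_limit.
Variables (I : Type) (le : rel I) (S : inverse_system le).

Definition coord (i : I) (x : inverse_limit S) : S i := set_val x i.

Lemma coordK (x : inverse_limit S) (i j : I) (ij : le i j) :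
  bond S ij (coord j x) = coord i x.
Proof. exact: (set_val_in x). Qed.

Lemma coord_inj (x y : inverse_limit S) :
  (forall i, coord i x = coord i y) -> x = y.
Proof.
by move=> xy; apply: set_val_inj; apply: functional_extensionality_dep.
Qed.

Lemma continuous_coord (i : I) : continuous (coord i).
Proof.
exact: comp_continuous (@set_val_continuous _ _) (@coord_continuous _ _ i).
Qed.

Lemma thread_exists (z : forall i, S i) :
  (forall i j (ij : le i j), bond S ij (z j) = z i) ->
  exists x : inverse_limit S, forall i, coord i x = z i.
Proof. by move=> zP; exists (SigSub (mem_set (zP : threads S z))). Qed.

Hypotheses (hS : forall i, hausdorff_space (S i)).

Lemma inverse_limit_hausdorff : hausdorff_space (inverse_limit S).
Proof. by apply: hausdorff_set_type; exact: hausdorff_prod_topology. Qed.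

Lemma inverse_limit_compact :
  (forall i, compact [set: S i]) -> compact [set: inverse_limit S].
Proof.
move=> cS; apply: compact_set_type.
apply: (@subclosed_compact _ _ [set: prod_topology (fun i => S i)]) => //.
  rewrite (_ : threads S = \bigcap_(t in [set: {ij : I * I | le ij.1 ij.2}])
    [set x : prod_topology (fun i => S i) |
      bond S (svalP t) (x (sval t).2) = x (sval t).1]).
    apply: closed_bigI => -[[i j] /= ij] _; apply: closed_equalizer => //.
      by apply: comp_continuous (@coord_continuous _ _ j) _; exact: bond_continuous.
    exact: (@coord_continuous _ _ i).
  apply/seteqP; split => [x xP [[i j] /= ij] _|x xP i j ij] /=; first exact: xP.
  pose t : {ij : I * I | le ij.1 ij.2} := exist _ (i, j) ij.
  by rewrite (bool_irrelevance ij (svalP t)); exact: (xP t Logic.I).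
exact: (@compact_prod_topology I (fun i => S i)).
Qed.

End inverse_limit.

(** * Coherent sections along a continuous sequence of retractions *)

Section inverse_sequence_of_retractions.
Variables (I : Type) (le : rel I) (S : inverse_system le).
Hypotheses (wo : wochoice.well_order le) (S_continuous : continuous_system S)
  (S_retraction : forall i j (ij : le i j), retraction (bond S ij))
  (cS : forall i, compact [set: S i]) (hS : forall i, hausdorff_space (S i)).

Lemma limit_eq (d : I) (y y' : S d) :
  limit_ordinal le d ->
  (forall i (id : le i d), slt le i d -> bond S id y = bond S id y') -> y = y'.
Proof.
move=> /S_continuous[f [g [cf cg fK gK fE]]] yy'; apply: (can_inj fK).
apply: set_val_inj; apply: functional_extensionality_dep => i.
rewrite !fE; apply: yy'; exact: svalP i.
Qed.

Lemma limit_exists (d : I) (z : forall i : below le d, S (sval i)) :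
  limit_ordinal le d ->
  (forall i j (ij : le (sval i) (sval j)), bond S ij (z j) = z i) ->
  exists y, forall i, bond S (slt_le i) y = z i.
Proof.
move=> /S_continuous[f [g [cf cg fK gK fE]]] zP.
pose x : inverse_limit (restr S d) :=
  SigSub (mem_set (zP : threads (restr S d) z)).
by exists (g x) => i; rewrite -fE gK.
Qed.

Definition section (i j : I) (ij : le i j) : S i -> S j :=
  s2val (cid2 (S_retraction ij).2).

Lemma section_cont (i j : I) (ij : le i j) : continuous (section ij).
Proof. exact: (s2valP (cid2 (S_retraction ij).2)). Qed.

Lemma sectionK (i j : I) (ij : le i j) : cancel (section ij) (bond S ij).
Proof. exact: (s2valP' (cid2 (S_retraction ij).2)). Qed.

Definition is_succ (i j : I) := slt le i j /\ forall k, slt le i k -> le j k.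

Lemma limit_or_succ (i j : I) :
  slt le i j -> (exists2 k, le i k & is_succ k j) \/
    (limit_ordinal le j /\ forall k, ~ is_succ k j).
Proof.
move=> ij; have [[k kj]|nk] := pselect (exists k, is_succ k j).
  left; exists k => //; apply: contrapT => nik.
  have /kj.2 ji : slt le k i by exact/(sltP wo).
  by move/(sltP wo): ij.
right; split; last by move=> k kj; apply: nk; exists k.
split; first by exists i.
move=> k kj; apply: contrapT => nl; apply: nk; exists k; split => // l kl.
have [//|lj] := wo_total wo j l; apply: contrapT => jl; apply: nl; exists l => //.
exact/(sltP wo).
Qed.

(* [w] is the [k]-th coordinate of the thread through [x : S i] whose
   coordinates above [i] follow the chosen sections at successor steps. *)
Definition follows (i : I) (x : S i) (k : I) (w : S k) : Prop :=
  [/\ forall ik : le i k, bond S ik w = x,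
      forall ki : le k i, w = bond S ki x &
      forall a b (ab : le a b) (ak : le a k) (bk : le b k),
        le i a -> is_succ a b -> bond S bk w = section ab (bond S ak w)].

Lemma follows_bond (i : I) (x : S i) (j k : I) (jk : le j k) (w : S k) :
  follows x w -> follows x (bond S jk w).
Proof.
move=> [wx xw ws]; split.
- by move=> ij; rewrite bond_comp; first exact: wo_trans jk; move=> ik.
- move=> ji; case: (wo_total wo i k) => [ik|ki].
    by rewrite -(wx ik) bond_comp.
  by rewrite (xw ki) bond_comp.
- move=> a b ab aj bj ia sab.
  have ak := wo_trans wo aj jk; have bk := wo_trans wo bj jk.
  by rewrite !(bond_comp _ _ ak, bond_comp _ _ bk); exact: ws.
Qed.

(** At a successor, [w] is the chosen section applied to the coordinate below; at a limit, the
    earlier coordinates determine it. *)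
Lemma follows_uniq (i : I) (x : S i) (k : I) (w w' : S k) :
  follows x w -> follows x w' -> w = w'.
Proof.
elim/(wo_ind wo): k w w' => k IH w w' xw xw'.
have [ki|nki] := boolP (le k i).
  by have [_ -> _] := xw; have [_ -> _] := xw'.
have ik : slt le i k by apply/(sltP wo)/negP.
case: (limit_or_succ ik) => [[j ij jk]|[lk _]].
  have lejk := slt_leW jk.1; have kk := wo_refl wo k.
  have [_ _ /(_ j k lejk lejk kk ij jk)] := xw; rewrite bond_id => ->.
  have [_ _ /(_ j k lejk lejk kk ij jk)] := xw'; rewrite bond_id => ->.
  by congr section; apply: IH jk.1 _ _ _ _; exact: follows_bond.
by apply: limit_eq lk _ => j jk ltjk; apply: IH => //; exact: follows_bond.
Qed.

Lemma follows_ex (i : I) (x : S i) (k : I) : exists w : S k, follows x w.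
Proof.
elim/(wo_ind wo): k => k IH.
have [ki|nki] := boolP (le k i).
  exists (bond S ki x); split.
  - by move=> ik; rewrite (bond_comp _ _ (wo_refl wo i)) bond_id.
  - by move=> ki'; rewrite (bool_irrelevance ki ki').
  - move=> a b ab ak bk ia [/(sltP wo) nba _]; case: nba.
    exact: (wo_trans wo bk (wo_trans wo ki ia)).
have ik : slt le i k by apply/(sltP wo)/negP.
case: (limit_or_succ ik) => [[j ij jk]|[lk nsk]].
  have lejk := slt_leW jk.1; have [v xv] := IH j jk.1.
  have [vx _ vs] := xv; exists (section lejk v).
  have bondj : bond S lejk (section lejk v) = v by rewrite sectionK.
  split.
  - by move=> ik'; rewrite -(bond_comp ij lejk) bondj.
  - by move=> ki; rewrite ki in nki.
  - move=> a b ab ak bk ia sab.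
    have [bj|nbj] := boolP (le b j).
      have aj := wo_trans wo ab bj.
      by rewrite -(bond_comp bj lejk) -(bond_comp aj lejk) bondj; exact: vs.
    have kb : le k b by apply: jk.2; apply/(sltP wo)/negP.
    have bE : b = k by exact: (wo_anti wo).
    (* Both [a] and [j] are immediate predecessors of [k]. *)
    have aE : a = j.
      subst b; apply: (wo_anti wo).
        case: (wo_total wo a j) => // ja; apply: contrapT => naj.
        have /jk.2 ka : slt le j a by exact/(sltP wo).
        by have /(sltP wo) := sab.1.
      case: (wo_total wo a j) => // aj; apply: contrapT => nja.
      have /sab.2 kj : slt le a j by exact/(sltP wo).
      by have /(sltP wo) := jk.1.
    subst a b; rewrite bond_id (bool_irrelevance ak lejk) bondj.
    by rewrite (bool_irrelevance ab lejk).
(* At a limit, uniqueness makes the coordinates found below [k] compatible, so they form a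
   thread. *)
pose z (j : below le k) : S (sval j) := sval (cid (IH (sval j) (svalP j))).
have zP j : follows x (z j) by exact: svalP (cid (IH (sval j) (svalP j))).
have [|y yz] := @limit_exists k z lk.
  by move=> a b ab; apply: follows_uniq (zP a); apply: follows_bond.
exists y; split.
- move=> ik'; pose j : below le k := exist _ i ik.
  have [+ _ _] := zP j; move=> /(_ (wo_refl wo i)); rewrite bond_id -yz => <-.
  by rewrite (bool_irrelevance ik' (slt_le j)).
- by move=> ki; rewrite ki in nki.
- move=> a b ab ak bk ia sab.
  have ltbk : slt le b k.
    apply/(sltP wo) => kb; have bE : b = k by exact: (wo_anti wo).
    by subst b; exact: nsk sab.
  pose b' : below le k := exist _ b ltbk.
  have [_ _ /(_ a b ab ab (wo_refl wo b) ia sab)] := zP b'.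
  rewrite bond_id -yz (bool_irrelevance bk (slt_le b')) => ->.
  by rewrite (bond_comp _ _ ak).
Qed.

Lemma embed_ex (i : I) (x : S i) :
  exists z : inverse_limit S, forall k, follows x (coord k z).
Proof.
pose z k : S k := sval (cid (follows_ex x k)).
have zP k : follows x (z k) by exact: svalP (cid (follows_ex x k)).
have [|t tz] := @thread_exists _ _ S z.
  by move=> a b ab; apply: follows_uniq (zP a); apply: follows_bond.
by exists t => k; rewrite tz.
Qed.

Definition embed (i : I) (x : S i) : inverse_limit S := sval (cid (embed_ex x)).

Lemma embedP (i : I) (x : S i) (k : I) : follows x (coord k (embed x)).
Proof. exact: svalP (cid (embed_ex x)) k. Qed.

(** This is the range of [embed] at [i], cut out by equations and hence closed. Continuity of
    [embed] then follows from compactness, without induction along the sequence. *)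
Definition follower (i : I) : set (inverse_limit S) :=
  [set z | forall a b (ab : le a b), le i a -> is_succ a b ->
     coord b z = section ab (coord a z)].

Lemma embedK (i : I) : cancel (@embed i) (coord i).
Proof.
by move=> x; have [/(_ (wo_refl wo i)) + _ _] := embedP x i; rewrite bond_id.
Qed.

Lemma follower_embed (i : I) (x : S i) : follower i (embed x).
Proof.
move=> a b ab ia sab; have [_ _ /(_ a b ab ab (wo_refl wo b) ia sab)] := embedP x b.
by rewrite bond_id coordK.
Qed.

Lemma embed_follower (i : I) (z : inverse_limit S) :
  follower i z -> embed (coord i z) = z.
Proof.
move=> zi; apply: coord_inj => k; apply: follows_uniq (embedP _ _) _.
split.
- by move=> ik; rewrite coordK.
- by move=> ki; rewrite coordK.
- by move=> a b ab ak bk ia sab; rewrite !coordK; exact: zi.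
Qed.

Lemma follower_closed (i : I) : closed (follower i).
Proof.
rewrite (_ : follower i = \bigcap_(t in [set t : {ab : I * I | le ab.1 ab.2} |
      le i (sval t).1 /\ is_succ (sval t).1 (sval t).2])
  [set z | coord (sval t).2 z = section (svalP t) (coord (sval t).1 z)]).
  apply: closed_bigI => -[[a b] /= ab] _; apply: closed_equalizer => //.
    exact: continuous_coord.
  apply: comp_continuous (@continuous_coord _ _ _ _) _; exact: section_cont.
apply/seteqP; split => [z zP [[a b] /= ab] [ia sab]|z zP a b ab ia sab] /=.
  exact: zP.
pose t : {ab : I * I | le ab.1 ab.2} := exist _ (a, b) ab.
by rewrite (bool_irrelevance ab (svalP t)); exact: (zP t (conj ia sab)).
Qed.

Lemma embed_continuous (i : I) : continuous (@embed i).
Proof.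
apply: (@section_continuous _ _ (follower i) (coord i)) => //.
- exact: inverse_limit_compact.
- exact: follower_closed.
- exact: continuous_coord.
- exact: follower_embed.
- exact: embedK.
- exact: embed_follower.
Qed.

Lemma inverse_limit_no_cutting_P_point :
  (forall i (q : S i), ~ cutting_P_point q) ->
  forall p : inverse_limit S, ~ cutting_P_point p.
Proof.
move=> nS p /cutting_P_pointP[A [B [[clA clB] AB ABp PA PB]]].
(* Over an empty index type all threads are equal, so [p] would be isolated. *)
have [[i0]|nI] := pselect (inhabited I); last first.
  have [x [_ _ []]] := PA.1 setT filterT; apply: coord_inj => i.
  by case: nI; exists.
pose r i (x : inverse_limit S) := embed (coord i x).
have cr i : continuous (r i).
  exact: comp_continuous (@continuous_coord _ _ _ _) (@embed_continuous i).
have coord_r i x : coord i (r i x) = coord i x by rewrite embedK.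
have r_le i j x : le i j -> r i (r j x) = r i x.
  by move=> ij; congr embed; rewrite -(coordK (r j x) ij) coord_r coordK.
have r_ge i j x : le i j -> r j (r i x) = r i x.
  move=> ij; apply: embed_follower => a b ab ja; apply: follower_embed.
  exact: wo_trans ja.
have r_limit d x y : limit_ordinal le d -> r d y = y ->
    (forall i, slt le i d -> r i y = r i x) -> y = r d x.
  move=> ld ydy yx; rewrite -ydy; congr embed; apply: limit_eq ld _ => i id ltid.
  by rewrite !coordK -(coord_r i x) -yx // coord_r.
have r_total x y : (forall i, r i y = r i x) -> y = x.
  by move=> xy; apply: coord_inj => i; rewrite -(coord_r i x) -xy coord_r.
have cX := inverse_limit_compact hS cS.
have hX := inverse_limit_hausdorff hS.
(* If from [i1] on no retraction maps a neighbourhood of [p] into [A], each of them maps one into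
   [B], since otherwise [S j] would have a cutting P-point. The argument is then repeated with [A]
   and [B] exchanged. *)
have [cofA|/existsNP[i1 ni1]] := pselect (forall i, exists2 j, le i j &
    exists2 W, open_nbhs p W & forall x, W x -> A (r j x)).
  exact: (not_cofinally_mapped wo cX hX cr r_le r_ge r_limit r_total
    clA clB AB ABp PB i0 cofA).
apply: (not_cofinally_mapped wo cX hX cr r_le r_ge r_limit r_total
  clB clA _ _ PA i0); rewrite 1?setUC 1?setIC // => i.
have [j [ij i1j]] := wo_upper2 wo i i1; exists j => //.
apply: contrapT => nB; apply: (nS j (coord j p)).
apply: (cutting_P_point_section (e := @embed j) (A := A) (B := B)) => //.
- exact: continuous_coord.
- exact: embed_continuous.
- exact: embedK.
- by move=> jA; apply: ni1; exists j.
Qed.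

End inverse_sequence_of_retractions.

Lemma homeomorphic_no_cutting_P_point (X Y : topologicalType) :
  homeomorphic X Y -> (forall p : X, ~ cutting_P_point p) ->
  forall q : Y, ~ cutting_P_point q.
Proof.
move=> [f [g [cf cg fK gK]]] nX q.
move=> /cutting_P_pointP[A [B [[clA clB] AB ABq PA PB]]].
apply: (nX (g q)).
have preP C : P_in C q -> P_in (f @^-1` C) (g q).
  move=> PC; apply: P_in_section => // W qW.
  by have [x [Wx Cx xq]] := PC.1 _ qW; exists x; rewrite gK.
apply/cutting_P_pointP; exists (f @^-1` A), (f @^-1` B); split.
- by split; exact: continuous_closed_preimage.
- by rewrite -preimage_setU AB preimage_setT.
- rewrite -preimage_setI ABq; apply/seteqP; split => [y /= yp|y ->] //=.
  by rewrite -yp fK.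
- exact: preP.
- exact: preP.
Qed.

(** Compactness and the Hausdorff property are carried along because the limit step uses them for
    every [S i]. *)
Theorem classR_no_cutting_P_point (R : realType) (X : topologicalType) :
  classR R X ->
  [/\ compact [set: X], hausdorff_space X & forall p : X, ~ cutting_P_point p].
Proof.
elim=> {X} [X cX mX|I le S X wo Sc Sr _ IH XS].
  split => //.
    have [M XM] := mX.
    by apply: (homeomorphic_hausdorff (homeomorphic_sym XM)); exact: metric_hausdorff.
  by move=> p; exact: metrizable_no_cutting_P_point mX.
have cS i : compact [set: S i] by have [] := IH i.
have hS i : hausdorff_space (S i) by have [] := IH i.
have SX := homeomorphic_sym XS.
split.
- by apply: homeomorphic_compact SX _; exact: inverse_limit_compact.
- by apply: homeomorphic_hausdorff SX _; exact: inverse_limit_hausdorff.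
- apply: homeomorphic_no_cutting_P_point SX _.
  by apply: inverse_limit_no_cutting_P_point => // i q; have [_ _] := IH i; apply.
Qed.

(** * Members of R built from retractions *)

(** The map from [Y] to the threads is onto by compactness: points with one prescribed coordinate
    each cluster at a point having all of them. It is then a continuous bijection from a compact to
    a Hausdorff space. *)
Lemma is_inverse_limit_compact (I : Type) (le : rel I) (S : inverse_system le)
    (Y : topologicalType) (q : forall i, Y -> S i) :
  (forall i, le i i) -> (forall i j k, le i j -> le j k -> le i k) ->
  (forall i j, exists k, le i k /\ le j k) -> inhabited I ->
  compact [set: Y] -> (forall i, hausdorff_space (S i)) ->
  (forall i, continuous (q i)) ->
  (forall i j (ij : le i j) y, bond S ij (q j y) = q i y) ->
  (forall x y, (forall i, q i x = q i y) -> x = y) ->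
  (forall i s, exists y, q i y = s) ->
  is_inverse_limit q.
Proof.
move=> lexx letr ledir [i0] cY hS cq qb qinj qsurj.
have qP y : threads S (fun i => q i y) by move=> i j ij; exact: qb.
pose f y : inverse_limit S := SigSub (mem_set (qP y)).
have [|||x|g cg [fK gK]] := @compact_bijection_homeomorphic _ _ f cY.
- exact: inverse_limit_hausdorff.
- by apply: continuous_set_type; apply: continuous_prod_topology; exact: cq.
- by move=> x y xy; apply: qinj => i; have /(congr1 (coord i)) := xy.
- have /choice[z zx] i := qsurj i (coord i x).
  have [|||||y _ yP] := @net_cluster _ setT _ setT le z cY.
  + by [].
  + by exists i0.
  + by move=> i _; exact: lexx.
  + by move=> i j _ _; have [k [ik jk]] := ledir i j; exists k.
  + by move=> i j k _ _ _; exact: letr.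
  exists y; apply: coord_inj => i; apply: (yP i [set y | q i y = coord i x]) => //.
    by apply: closed_equalizer => // t; exact: cvg_cst.
  by move=> j _ ij /=; rewrite -(qb _ _ ij) zx coordK.
- exists f, g; split => //.
  by apply: continuous_set_type; apply: continuous_prod_topology; exact: cq.
Qed.

Lemma classR_homeomorphic (R : realType) (X Y : topologicalType) :
  homeomorphic X Y -> classR R Y -> classR R X.
Proof.
move=> XY RY; case: RY XY => {Y} [Y cY [M YM]|I le S Y wo Sc Sr SR YS] XY.
  apply: classR_metrizable.
    exact: homeomorphic_compact (homeomorphic_sym XY) cY.
  by exists M; exact: homeomorphic_trans YM.
by apply: (classR_limit wo Sc Sr SR); exact: homeomorphic_trans YS.
Qed.

Section retracts.
Variables (R : realType) (X : topologicalType) (I : Type) (le : rel I)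
  (F : set X) (E : I -> set X) (r : I -> X -> X).
Hypotheses (hX : hausdorff_space X) (wo : wochoice.well_order le)
  (I0 : inhabited I) (cF : compact F) (clE : forall i, closed (E i))
  (EF : forall i, E i `<=` F) (Emono : forall i j, le i j -> E i `<=` E j)
  (cr : forall i, continuous (fun x : F => r i (set_val x)))
  (rE : forall i x, F x -> E i (r i x)) (r_id : forall i x, E i x -> r i x = x)
  (r_comp : forall i j x, le i j -> F x -> r i (r j x) = r i x)
  (r_limit : forall d x y, limit_ordinal le d -> E d x -> E d y ->
     (forall i, slt le i d -> r i x = r i y) -> x = y)
  (r_total : forall x y, F x -> F y -> (forall i, r i x = r i y) -> x = y).

Definition inclusion (A B : set X) (AB : A `<=` B) (x : A) : B :=
  SigSub (mem_set (AB _ (set_val_in x))).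

Lemma inclusion_continuous (A B : set X) (AB : A `<=` B) :
  continuous (inclusion AB).
Proof. by apply: continuous_set_type; exact: set_val_continuous. Qed.

Definition retract (i : I) (x : F) : E i :=
  SigSub (mem_set (rE i (set_val_in x))).

Lemma retract_continuous (i : I) : continuous (retract i).
Proof. by apply: continuous_set_type; exact: cr. Qed.

Definition retract_bond (i j : I) (ij : le i j) (x : E j) : E i :=
  retract i (inclusion (@EF j) x).

Lemma retract_bond_continuous (i j : I) (ij : le i j) :
  continuous (retract_bond ij).
Proof.
exact: comp_continuous (@inclusion_continuous _ _ _) (@retract_continuous i).
Qed.

Lemma retract_bond_id (i : I) (ii : le i i) (x : E i) : retract_bond ii x = x.
Proof. by apply: set_val_inj; have := r_id (set_val_in x). Qed.

Lemma retract_bond_comp (i j k : I) (ij : le i j) (jk : le j k) (ik : le i k)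
  (x : E k) : retract_bond ij (retract_bond jk x) = retract_bond ik x.
Proof. by apply: set_val_inj; apply: (r_comp ij); exact: (EF (set_val_in x)). Qed.

Definition retract_system : inverse_system le :=
  InverseSystem retract_bond_continuous retract_bond_id retract_bond_comp.

Lemma retract_system_retraction (i j : I) (ij : le i j) :
  retraction (bond retract_system ij).
Proof.
split; first exact: retract_bond_continuous.
exists (inclusion (Emono ij)); first exact: inclusion_continuous.
by move=> x; apply: set_val_inj; have := r_id (set_val_in x).
Qed.

Lemma retract_system_continuous : continuous_system retract_system.
Proof.
move=> d ld; apply: is_inverse_limit_compact.
- by move=> i; exact: (wo_refl wo (sval i)).
- by move=> i j k; exact: (wo_trans wo).
- move=> i j; case: (wo_total wo (sval i) (sval j)) => ij.
    by exists j; split => //; exact: (wo_refl wo (sval j)).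
  by exists i; split => //; exact: (wo_refl wo (sval i)).
- by have [[i ltid] _] := ld; constructor; exists i.
- apply: compact_set_type; apply: subclosed_compact cF _ => //; exact: EF.
- by move=> i; exact: hausdorff_set_type.
- by move=> i; exact: retract_bond_continuous.
- by move=> i j ij y; exact: retract_bond_comp.
- move=> x y xy; apply: set_val_inj; apply: r_limit ld _ _ _.
  + exact: set_val_in.
  + exact: set_val_in.
  + move=> i ltid; pose i' : below le d := exist _ i ltid.
    by have /(congr1 set_val) := xy i'.
- move=> i s; have [_ [g _ gK]] := retract_system_retraction (slt_le i).
  by exists (g s).
Qed.

(** The sets [E i], bonded by restrictions of the [r i] with the inclusions as right inverses, form
    a continuous sequence with limit [F]. Membership in the class is thus reduced to data inside one
    space. *)
Lemma classR_retracts : (forall i, classR R (E i)) -> classR R F.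
Proof.
move=> RE; apply: (@classR_limit R I le retract_system) => //.
- exact: retract_system_continuous.
- exact: retract_system_retraction.
have [||||||||||f [g [cf cg fK gK _]]] :=
    @is_inverse_limit_compact I le retract_system F retract.
- by move=> i; exact: wo_refl.
- by move=> i j k; exact: wo_trans.
- exact: wo_upper2.
- by [].
- exact: compact_set_type.
- by move=> i; exact: hausdorff_set_type.
- exact: retract_continuous.
- by move=> i j ij y; apply: set_val_inj; apply: r_comp => //; exact: set_val_in.
- move=> x y xy; apply: set_val_inj; apply: r_total; try exact: set_val_in.
  by move=> i; have /(congr1 set_val) := xy i.
- move=> i s; exists (inclusion (@EF i) s); apply: set_val_inj.
  by have := r_id (set_val_in s).
- by exists f, g.
Qed.

End retracts.

(** A copy of [X], so that the zero-one metric does not interfere with a topology already present on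
    [X]. *)
Definition discrete_metric (R : realType) (X : Type) : Type := X.

Section discrete_metric.
Variables (R : realType) (X : choiceType).
Local Notation M := (discrete_metric R X).
Local Open Scope ring_scope.

HB.instance Definition _ := Choice.on M.

Definition discrete_dist (x y : M) : R := (x != y)%:R.

Lemma discrete_distxx (x : M) : discrete_dist x x = 0.
Proof. by rewrite /discrete_dist eqxx. Qed.

Lemma discrete_dist_positivity (x y : M) : discrete_dist x y = 0 -> x = y.
Proof.
by rewrite /discrete_dist; case: eqP => //= _ /eqP; rewrite oner_eq0.
Qed.

Lemma discrete_dist_sym (x y : M) : discrete_dist x y = discrete_dist y x.
Proof. by rewrite /discrete_dist eq_sym. Qed.

Lemma discrete_dist_triangle (y x z : M) :
  discrete_dist x z <= discrete_dist x y + discrete_dist y z.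
Proof.
rewrite /discrete_dist -natrD ler_nat.
by case: (x =P y) => [->|_]; [|case: (x != z)].
Qed.

HB.instance Definition _ := @isMetric.Build R M discrete_dist discrete_distxx
  discrete_dist_positivity discrete_dist_sym discrete_dist_triangle.

Lemma discrete_metric_nbhs (x : M) : nbhs x [set x].
Proof.
apply/nbhs_ballP; exists 1; first by rewrite /= ltr01.
move=> y; rewrite ballEmdist /= /mdist /= /discrete_dist.
by case: eqP => // _; rewrite ltxx.
Qed.

End discrete_metric.

Lemma discrete_metrizable (R : realType) (X : topologicalType) :
  (forall x : X, nbhs x [set x]) -> metrizable R X.
Proof.
move=> dX; exists (discrete_metric R X); exists id, id; split => // x U.
  by move=> xU; apply: filterS (dX x) => _ ->; exact: (nbhs_singleton xU).
move=> xU; apply: filterS (discrete_metric_nbhs (x : discrete_metric R X)).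
by move=> _ ->; exact: (nbhs_singleton xU).
Qed.

Lemma classR_finite (R : realType) (X : topologicalType) (F : set X) :
  hausdorff_space X -> finite_set F -> classR R F.
Proof.
move=> hX fF; apply: classR_metrizable.
  by apply: compact_set_type; exact: finite_compact.
apply: discrete_metrizable => x; apply/nbhs_set_type.
exists (~` (F `\ set_val x)).
  apply: open_nbhs_nbhs; split; last by move=> [_ /=].
  apply: closed_openC; apply: compact_closed => //; apply: finite_compact.
  exact: finite_setD.
move=> y /= nFy; apply: set_val_inj; apply: contrapT => yx; apply: nFy.
by split => //; exact: set_val_in.
Qed.

(** * Ordered compacta *)

Section dual_order_topology.
Variables (disp : Order.disp_t) (K : orderTopologicalType disp).

HB.instance Definition _ := Topological.copy (Order.dual K) K.

Definition dual_bound (T : Type) (b : itv_bound T) : itv_bound (Order.dual T) :=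
  match b with BSide s x => BSide (~~ s) x | BInfty s => BInfty _ (~~ s) end.

Lemma mem_dual_itv (l r : itv_bound K) (x : K) :
  ((x : Order.dual K) \in Interval (dual_bound r) (dual_bound l)) =
  (x \in Interval l r).
Proof.
by rewrite !itv_boundlr andbC; case: l r => [[] l|[]] [[] r|[]].
Qed.

(** The open intervals of the dual are those of [K] with their ends exchanged. This lets statements
    about left ends be transferred to right ends. *)
Lemma dual_itv_nbhsE (x : Order.dual K) : nbhs x = filter_from
  (fun i : interval (Order.dual K) => itv_open_ends i /\ x \in i)
  (fun i => [set` i]).
Proof.
have -> : nbhs x = nbhs (x : K) by [].
rewrite itv_nbhsE; apply/seteqP; split => U [[l r] [oi xi] iU].
  exists (Interval (dual_bound r) (dual_bound l)).
    split; last by rewrite mem_dual_itv.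
    by move: oi; case: (l) (r) => [[] ?|[]] [[] ?|[]].
  by move=> y /=; rewrite mem_dual_itv => /iU.
have lK (b : itv_bound (Order.dual K)) :
    exists b' : itv_bound K, b = dual_bound b'.
  case: b => s; last by exists (BInfty _ (~~ s)); rewrite /= negbK.
  by move=> y; exists (BSide (~~ s) (y : K)); rewrite /= negbK.
have [l' lE] := lK l; have [r' rE] := lK r; subst l r.
exists (Interval r' l').
  split; last by rewrite -mem_dual_itv.
  by move: oi; case: (l') (r') => [[] ?|[]] [[] ?|[]].
by move=> y /=; rewrite -mem_dual_itv => /iU.
Qed.

HB.instance Definition _ :=
  Order_isNbhs.Build _ (Order.dual K) dual_itv_nbhsE.

End dual_order_topology.

Lemma seq_max (disp : Order.disp_t) (K : orderType disp) (a : K) (s : seq K) :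
  exists2 m, m \in a :: s & forall x, x \in a :: s -> (x <= m)%O.
Proof.
elim: s a => [|b s IH] a.
  by exists a; rewrite ?mem_head // => x; rewrite inE => /eqP->.
have [m ms mP] := IH b; case: (leP a m) => am.
  exists m; first by rewrite inE ms orbT.
  by move=> x; rewrite inE => /predU1P[->//|]; exact: mP.
exists a; first exact: mem_head.
move=> x; rewrite inE => /predU1P[->//|/mP xm]; exact: le_trans xm (ltW am).
Qed.

Lemma seq_min (disp : Order.disp_t) (K : orderType disp) (a : K) (s : seq K) :
  exists2 m, m \in a :: s & forall x, x \in a :: s -> (m <= x)%O.
Proof. exact: (@seq_max _ (Order.dual K) a s). Qed.

(** * Embedding the rationals along a dense relation *)

Section rat_embedding.
Variables (disp : Order.disp_t) (K : orderType disp) (lt' : K -> K -> Prop).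
Hypotheses (lt'_lt : forall a b, lt' a b -> (a < b)%O)
  (lt'_le : forall a b c, lt' a b -> (b <= c)%O -> lt' a c)
  (le_lt' : forall a b c, (a <= b)%O -> lt' b c -> lt' a c)
  (lt'_dense : forall a b, lt' a b -> exists c, lt' a c /\ lt' c b).
Variables (a b : K).
Hypothesis ab : lt' a b.

Definition good (s : seq (rat * K)) : Prop :=
  (forall t, t \in s -> lt' a t.2 /\ lt' t.2 b) /\
  (forall t t', t \in s -> t' \in s -> (t.1 < t'.1)%O -> lt' t.2 t'.2).

(** By density [v] is taken between [l], the largest of [a] and the values at rationals below [x],
    and [u], the smallest of [b] and the values at rationals above [x]. *)
Lemma good_extend (s : seq (rat * K)) (x : rat) :
  good s -> exists v, good ((x, v) :: s).
Proof.
move=> [sab ss].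
have [l ls lP] := seq_max a [seq t.2 | t <- s & (t.1 < x)%O].
have [u us uP] := seq_min b [seq t.2 | t <- s & (x < t.1)%O].
have /lt'_dense[v [lv vu]] : lt' l u.
  move: ls us; rewrite !inE => /predU1P[->|/mapP[t]].
    by move=> /predU1P[->//|/mapP[t]]; rewrite mem_filter => /andP[_ /sab[]] ? _ ->.
  rewrite mem_filter => /andP[tx ts] ->.
  move=> /predU1P[->|/mapP[t']]; first by have [] := sab _ ts.
  rewrite mem_filter => /andP[xt' t's] ->; apply: ss => //; exact: lt_trans xt'.
have av : lt' a v by apply: le_lt' lv; apply: lP; exact: mem_head.
have vb : lt' v b by apply: lt'_le vu _; apply: uP; exact: mem_head.
exists v; split => [t|t t']; first by rewrite inE => /predU1P[->//|]; exact: sab.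
rewrite !inE => /predU1P[->|ts] /predU1P[->|t's] /= lttt'.
- by rewrite ltxx in lttt'.
- apply: lt'_le vu _; apply: uP; rewrite inE; apply/orP; right; apply/mapP.
  by exists t'; rewrite // mem_filter lttt'.
- apply: le_lt' lv; apply: lP; rewrite inE; apply/orP; right; apply/mapP.
  by exists t; rewrite // mem_filter lttt'.
- exact: ss.
Qed.

Lemma rat_embedding : exists f : rat -> K, {mono f : x y / (x <= y)%O}.
Proof.
have /choice[ext extP] (tx : {s | good s} * rat) :
    exists v, good ((tx.2, v) :: sval tx.1).
  by apply: good_extend; exact: svalP.
have good0 : good [::] by [].
(* Stage [n] handles the rational with code [n]; if [n] codes nothing, the approximation is left
   unchanged. *)
pose step (n : nat) (t : {s | good s}) : {s | good s} :=
  if unpickle n is Some x then exist _ _ (extP (t, x)) else t.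
pose approx n := iteri n step (exist _ [::] good0).
pose f (x : rat) := ext (approx (pickle x), x).
have approx_mono m n : (m <= n)%N ->
    {subset sval (approx m) <= sval (approx n)}.
  elim: n => [|n IH]; first by rewrite leqn0 => /eqP->.
  rewrite leq_eqVlt ltnS => /predU1P[->//|/IH mn] t /mn tn.
  rewrite /approx /= -/(approx n) /step; case: unpickle => //= x.
  by rewrite inE tn orbT.
have fP x : (x, f x) \in sval (approx (pickle x).+1).
  by rewrite /approx /= -/(approx _) /step pickleK /= mem_head.
exists f; apply: le_mono => x y xy; apply: lt'_lt.
pose n := maxn (pickle x).+1 (pickle y).+1.
have [_ /(_ (x, f x) (y, f y))] := svalP (approx n).
by apply => //; apply: approx_mono (fP _); rewrite /n ?leq_maxl ?leq_maxr.
Qed.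

End rat_embedding.

Section compact_order.
Variables (disp : Order.disp_t) (K : orderTopologicalType disp).
Hypothesis cK : compact [set: K].

(** [S], directed by its own order, is a net; closed rays show that its cluster point is the
    supremum. *)
Lemma compact_sup (S : set K) : S !=set0 ->
  exists s, (forall x, S x -> (x <= s)%O) /\
    forall u, (forall x, S x -> (x <= u)%O) -> (s <= u)%O.
Proof.
move=> S0.
have [||||s _ sP] := @net_cluster _ setT _ S (fun x y => (x <= y)%O) id cK _ S0.
- by [].
- by move=> x _; exact: lexx.
- by move=> x y Sx Sy; case: (leP x y) => xy; [exists y|exists x]; rewrite ?(ltW xy).
- by move=> x y z _ _ _; exact: le_trans.
exists s; split=> [x Sx|u uP].
  have := sP x [set` `[x, +oo[%O] Sx (@rray_closed _ K x).
  rewrite /= in_itv /= andbT; apply => y _ xy.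
  by rewrite /= in_itv /= andbT.
have [x Sx] := S0.
have := sP x [set` `]-oo, u]%O] Sx (@lray_closed _ K u).
rewrite /= in_itv /=; apply => y Sy _.
by rewrite /= in_itv /=; exact: uP.
Qed.

End compact_order.

Lemma compact_inf (disp : Order.disp_t) (K : orderTopologicalType disp)
    (S : set K) : compact [set: K] -> S !=set0 ->
  exists s, (forall x, S x -> (s <= x)%O) /\
    forall u, (forall x, S x -> (u <= x)%O) -> (u <= s)%O.
Proof. by move=> cK; exact: (@compact_sup _ (Order.dual K) cK S). Qed.

Lemma paste_continuous (X Y : topologicalType) (F P Q : set X) (f g h : X -> Y) :
  closed P -> closed Q -> F `<=` P `|` Q -> continuous g -> continuous h ->
  (forall x, F x -> P x -> f x = g x) -> (forall x, F x -> Q x -> f x = h x) ->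
  continuous (fun x : F => f (set_val x)).
Proof.
move=> clP clQ FPQ cg ch fg fh; apply/continuous_closedP => D clD.
rewrite (_ : _ @^-1` D = @set_val _ F @^-1` ((P `&` g @^-1` D) `|` (Q `&` h @^-1` D))).
  apply: continuous_closed_preimage; first exact: set_val_continuous.
  by apply: closedU; apply: closedI => //; exact: continuous_closed_preimage.
apply/seteqP; split => x /=; have Fx := set_val_in x.
  by move=> Dx; have [Px|Qx] := FPQ _ Fx; [left|right]; rewrite -?fg -?fh.
by move=> [[Px]|[Qx]]; [rewrite -fg|rewrite -fh].
Qed.

(** * Segments that can be added to members of the class *)

Section absorbing.
Variables (R : realType) (disp : Order.disp_t) (K : orderTopologicalType disp).
Implicit Types (x y t : K) (L F : set K).

Definition segment x y : set K := [set t | (x <= t)%O && (t <= y)%O].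

(** Finite sets are built in so that single points, such as an endpoint with an immediate
    predecessor, can be added at any time. *)
Definition stable F : Prop :=
  forall S : set K, finite_set S -> classR R (F `|` S : set K).

(** Quantifying over [L] allows disjoint segments to be added one after the other. *)
Definition absorbed x y : Prop := forall L, closed L ->
  (forall t, L t -> ~ segment x y t) -> stable L -> stable (L `|` segment x y).

Lemma segment_closed x y : closed (segment x y).
Proof.
rewrite (_ : segment x y = [set` `[x, y]%O]); first exact: itv_closed.
by apply/seteqP; split => t; rewrite /segment /= in_itv.
Qed.

Lemma closed_finite (S : set K) : finite_set S -> closed S.
Proof. by move=> fS; apply: compact_closed order_hausdorff (finite_compact fS). Qed.

Lemma stableU F (S : set K) : finite_set S -> stable F -> stable (F `|` S).
Proof.
by move=> fS sF T fT; rewrite -setUA; apply: sF; rewrite finite_setU.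
Qed.

Lemma absorbed_finite x y : finite_set (segment x y) -> absorbed x y.
Proof. by move=> fxy L _ _; exact: stableU. Qed.

Lemma absorbed_refl x : absorbed x x.
Proof.
apply: absorbed_finite; rewrite (_ : segment x x = [set x]) //.
apply/seteqP; split => [t /andP[xt tx]|_ ->] /=; last by rewrite /segment /= lexx.
by apply/eqP; rewrite eq_le tx xt.
Qed.

Hypothesis cK : compact [set: K].

(* The elements of [x, y) that dominate all their predecessors for a
   well-order of K form a cofinal subset, well-ordered by the order of K. *)
Lemma cofinal_well_ordered x y : (x < y)%O -> exists C : set K,
  [/\ forall c, C c -> (x <= c)%O /\ (c < y)%O,
      forall t, (x <= t)%O -> (t < y)%O -> exists2 c, C c & (t <= c)%O &
      wochoice.well_order (fun i j : {c | C c} => (sval i <= sval j)%O)].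
Proof.
move=> xy; have [W woW] := wochoice.well_ordering_principle K.
pose inside t := (x <= t)%O /\ (t < y)%O.
pose C := [set c | inside c /\ forall j, inside j -> W j c -> (j <= c)%O].
exists C; split => [c [] //|t xt ty|].
  (* The [W]-least element [c] of [[t, y)] is in [C]: a point of [[x, y)] that precedes it for [W]
     is below [t] or equal to [c]. *)
  have [|c [tc cy] cP] := @wo_min _ _ woW [set c | (t <= c)%O /\ (c < y)%O].
    by exists t.
  exists c => //; split; first by split => //; exact: le_trans tc.
  move=> j [xj jy] Wjc; case: (leP t j) => tj; last exact: le_trans (ltW tj) tc.
  by rewrite (wo_anti woW Wjc) // cP.
move=> A [i0 Ai0].
(* The [W]-least member of [A] is also least in [K], since elements of [C] dominate their
   [W]-predecessors. *)
have [|m [i Ai im] mP] := @wo_min _ _ woW [set c | exists2 i, i \in A & sval i = c].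
  by exists (sval i0), i0.
exists i; split; last first.
  move=> j [Aj jP]; apply: eq_sig_hprop => [? ? ?|]; first exact: Prop_irrelevance.
  apply/eqP; rewrite eq_le jP // andbT.
  case: (svalP j) => jin; apply; first by case: (svalP i).
  by rewrite im; apply: mP; exists j.
split => // j Aj; case: (svalP j) => jin; apply; first by case: (svalP i).
by rewrite im; apply: mP; exists j.
Qed.

Lemma absorbed_limit x y :
  (forall t, (x <= t)%O -> (t < y)%O -> absorbed x t) -> absorbed x y.
Proof.
move=> IH; case: (ltgtP x y) => [xy|yx|<-]; last 2 first.
- apply: absorbed_finite; rewrite (_ : segment x y = set0) //.
  apply/seteqP; split => // t /andP[xt ty].
  by have := le_trans xt ty; rewrite leNgt yx.
- exact: absorbed_refl.
(* If [y] has an immediate predecessor in the segment, only the point [y] remains to be added. *)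
have [[t [xt ty tP]]|npred] := pselect (exists t, [/\ (x <= t)%O, (t < y)%O &
    forall u, (t < u)%O -> (y <= u)%O]).
  have E : segment x y = segment x t `|` [set y].
    apply/seteqP; split => [u /andP[xu uy]|u [/andP[xu ut]|->]].
    - case: (leP u t) => [ut|/tP yu]; first by left; apply/andP.
      by right; rewrite /=; apply/eqP; rewrite eq_le uy yu.
    - by apply/andP; split => //; exact: le_trans ut (ltW ty).
    - by rewrite /segment /= lexx ltW.
  move=> L clL Lxy sL; rewrite E setUA; apply: stableU => //.
  by apply: (IH t) => // u Lu xtu; apply: (Lxy u Lu); rewrite E; left.
move=> L clL Lxy sL S0 fS0.
(* Points of [S0] in the segment add nothing; the others are joined to [L], which keeps it disjoint
   from the segment. *)
pose S := S0 `\` segment x y; pose L' := L `|` S.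
have clL' : closed L'.
  by apply: closedU => //; apply: closed_finite; exact: finite_setD.
have L'xy t : L' t -> ~ segment x y t by move=> [/Lxy//|[]].
have -> : L `|` segment x y `|` S0 = L' `|` segment x y.
  apply/seteqP; split => t; rewrite /L' /S /=.
    by move=> [[?|?]|?]; [left; left|right|
      case: (pselect (segment x y t)) => ?; [right|left; right]].
  by move=> [[?|[? _]]|?]; [left; left|right|left; right].
have [C [Cxy Ccof woC]] := cofinal_well_ordered xy.
pose I := {c | C c}; pose le (i j : I) := (sval i <= sval j)%O.
have lt_slt (i j : I) : slt le i j -> (sval i < sval j)%O.
  by rewrite /slt /le ltNge => /andP[_].
(* [yb i] is the supremum of [x] and the members of [C] strictly before [i]. Truncating there rather
   than at [i] makes the sequence continuous at limits, where [i] may exceed that supremum. *)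
have /choice[yb ybP] (i : I) : exists s, [/\ (x <= s)%O,
    forall j : I, slt le j i -> (sval j <= s)%O &
    forall u, (x <= u)%O -> (forall j : I, slt le j i -> (sval j <= u)%O) -> (s <= u)%O].
  have [|s [sP smin]] := @compact_sup _ K cK
      [set t | t = x \/ exists2 j : I, slt le j i & t = sval j].
    by exists x; left.
  exists s; split; first by apply: sP; left.
    by move=> j ji; apply: sP; right; exists j.
  by move=> u xu uP; apply: smin => _ [->//|[j /uP ? ->]].
have yb_le i : (yb i <= sval i)%O.
  have [_ _] := ybP i; apply; first by have [] := Cxy _ (svalP i).
  by move=> j /lt_slt/ltW.
have yb_lt i : (yb i < y)%O.
  by apply: le_lt_trans (yb_le i) _; have [] := Cxy _ (svalP i).
have yb_ge i : (x <= yb i)%O by have [] := ybP i.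
have yb_mono i j : le i j -> (yb i <= yb j)%O.
  move=> ij; have [_ _] := ybP i; apply => // k ki.
  by have [_ + _] := ybP j; apply; exact: (slt_le_trans woC ki ij).
pose E i := L' `|` segment x (yb i).
(* Truncation stops at [y], so that points of [L'] above the segment are fixed; those below [x] are
   fixed because [x <= yb i]. *)
pose r i t := if (t <= y)%O then Order.min t (yb i) else t.
pose F := L' `|` segment x y.
have rL i t : L' t -> r i t = t.
  move=> /L'xy nt; rewrite /r; case: (leP t y) => // ty; apply: min_l.
  have tx : (t < x)%O by rewrite ltNge; apply/negP => xt; apply: nt; apply/andP.
  exact: le_trans (ltW tx) (yb_ge i).
(* Once [yb i] exceeds [s], [r i] fixes [s] and sends a larger [t] of the segment strictly above
   [s]. The bound [b] will be [yb d] at a limit [d], and [y] for the whole sequence. *)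
have r_sep (b s t : K) (J : set I) : F s -> (L' `|` segment x b) t -> (b <= y)%O ->
    J !=set0 -> (forall u, (x <= u)%O -> (u < b)%O -> exists2 i, J i & (u < yb i)%O) ->
    (s < t)%O -> exists2 i, J i & r i s <> r i t.
  move=> Fs bt bley [i0 Ji0] Jcof st.
  have r_le i : (r i s <= s)%O by rewrite /r; case: ifP => // _; rewrite ge_min lexx.
  case: bt => [L't|/andP[xt tb]].
    exists i0 => // rst; have := r_le i0; rewrite rst rL // => ts.
    by have := lt_le_trans st ts; rewrite ltxx.
  have [i Ji si] : exists2 i, J i & (s < yb i)%O.
    case: (leP x s) => xs; first by apply: Jcof xs (lt_le_trans st tb).
    by exists i0 => //; exact: lt_le_trans xs _.
  exists i => //; rewrite /r (le_trans tb bley) (le_trans (ltW st) (le_trans tb bley)).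
  rewrite (min_l (ltW si)) => /esym => mE.
  have : (s < Order.min t (yb i))%O by rewrite lt_min st si.
  by rewrite mE ltxx.
have ybF i : E i `<=` F.
  move=> t [L't|/andP[xt ti]]; [by left|right; apply/andP; split => //].
  exact: le_trans ti (ltW (yb_lt i)).
have [c0 Cc0 _] := Ccof x (lexx x) xy.
pose i0 : I := exist _ c0 Cc0.
apply: (@classR_retracts R K I le F E r).
- exact: order_hausdorff.
- exact: woC.
- by constructor.
- by apply: subclosed_compact cK _ => //; apply: closedU => //; exact: segment_closed.
- by move=> i; apply: closedU => //; exact: segment_closed.
- exact: ybF.
- move=> i j ij t [L't|/andP[xt ti]]; [by left|right; apply/andP; split => //].
  exact: le_trans ti (yb_mono _ _ ij).
- move=> i.
  (* The two closed pieces are disjoint, as [y] is not in [L']. *)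
  apply: (@paste_continuous _ _ _ (L' `&` [set` `[y, +oo[%O]) [set` `]-oo, y]%O]
    _ id (fun t => Order.min t (yb i))).
  + by apply: closedI => //; exact: rray_closed.
  + exact: lray_closed.
  + move=> t Ft; rewrite /setU /= !in_itv /= andbT.
    case: (leP t y) => ty; first by right.
    left; split; last exact: ltW.
    by case: Ft => // /andP[_]; rewrite leNgt ty.
  + by move=> t; exact: cvg_id.
  + by apply: min_fun_continuous => t; [exact: cvg_id|exact: cvg_cst].
  + by move=> t _ [/rL].
  + by move=> t _; rewrite /= in_itv /= /r => ->.
- move=> i t [L't|/andP[xt ty]]; first by rewrite rL //; left.
  right; rewrite /r ty; apply/andP; split; last by rewrite ge_min lexx orbT.
  by rewrite le_min xt yb_ge.
- move=> i t [/rL//|/andP[xt ti]].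
  by rewrite /r (le_trans ti (ltW (yb_lt i))) min_l.
- move=> i j t ij Ft; rewrite /r; case: (leP t y) => ty.
    rewrite (le_trans _ ty) ?ge_min ?lexx // -minA; congr Order.min.
    by apply: min_r; exact: yb_mono.
  by rewrite leNgt ty.
- move=> d s t ld Es Et rst.
  have Jcof u : (x <= u)%O -> (u < yb d)%O ->
      exists2 i, slt le i d & (u < yb i)%O.
    move=> xu ud; apply: contrapT => nu; move: ud; rewrite ltNge => /negP; apply.
    have [_ _] := ybP d; apply => // j jd.
    have [_ /(_ j jd)[k jk kd]] := ld; have [_ /(_ j jk) jyb _] := ybP k.
    rewrite leNgt; apply/negP => uj; apply: nu; exists k => //.
    exact: lt_le_trans uj jyb.
  have J0 : [set i | slt le i d] !=set0 by have [[i id] _] := ld; exists i.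
  have lyb := ltW (yb_lt d).
  case: (ltgtP s t) => // st.
    by have [i ltid] := r_sep _ _ _ _ (ybF _ _ Es) Et lyb J0 Jcof st;
      rewrite (rst _ ltid).
  by have [i ltid] := r_sep _ _ _ _ (ybF _ _ Et) Es lyb J0 Jcof st;
      rewrite (rst _ ltid).
- move=> s t Fs Ft rst.
  have Jcof u : (x <= u)%O -> (u < y)%O -> exists2 i : I, setT i & (u < yb i)%O.
    (* Without an immediate predecessor of [y], [C] has members strictly above any [v] in [[x, y)].
       This is used twice below, because [yb j] bounds only the members of [C] strictly before
       [j]. *)
    have next v : (x <= v)%O -> (v < y)%O -> exists2 i : I, (x <= sval i)%O &
        (v < sval i)%O.
      move=> xv vy; have [w [vw wy]] : exists w, (v < w)%O /\ (w < y)%O.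
        apply: contrapT => nw; apply: npred; exists v; split => // w vw.
        by rewrite leNgt; apply/negP => wy; apply: nw; exists w.
      have [c Cc wc] := Ccof w (le_trans xv (ltW vw)) wy.
      by exists (exist _ c Cc) => /=; [have [] := Cxy c Cc|exact: lt_le_trans wc].
    move=> xu uy; have [i xi ui] := next u xu uy.
    have [_ iy] := Cxy _ (svalP i); have [j xj ij] := next _ xi iy.
    exists j => //; apply: lt_le_trans ui _; have [_ + _] := ybP j; apply.
    by rewrite /slt /le (ltW ij) -ltNge.
  have J0 : [set: I] !=set0 by exists i0.
  case: (ltgtP s t) => // st.
    by have [i _] := r_sep _ _ _ _ Fs Ft (lexx y) J0 Jcof st; rewrite rst.
  by have [i _] := r_sep _ _ _ _ Ft Fs (lexx y) J0 Jcof st; rewrite rst.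
- move=> i; rewrite /E (_ : _ `|` _ = L `|` segment x (yb i) `|` S).
    apply: IH => //; last exact: finite_setD.
    move=> t Lt /andP[xt ti]; apply: (Lxy t Lt); apply/andP; split => //.
    exact: le_trans ti (ltW (yb_lt i)).
  by rewrite /L' setUAC.
Qed.

Lemma leq_well_order : wochoice.well_order leq.
Proof.
move=> A [n0 An0]; have exA : exists n, A n by exists n0.
case: (ex_minnP exA) => m Am mP; exists m; split.
  by split => // n An; exact: mP.
by move=> n [An nP]; apply/eqP; rewrite eqn_leq mP // nP.
Qed.

(** Over the index [nat] the separation condition at limits becomes vacuous. *)
Lemma leq_no_limit (d : nat) : ~ limit_ordinal leq d.
Proof.
rewrite /limit_ordinal /slt => -[[i]]; case: d => [|d]; first by case: i.
move=> _ /(_ d)[]; first by rewrite leqnSn ltnn.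
by move=> j; rewrite -!ltnNge => /andP[_ dj] /andP[_]; rewrite ltnS leqNgt dj.
Qed.

(* [z n] and [zs n] are consecutive in [K], so that the map sending
   [zs n, b] to [b] and fixing everything else is continuous. *)
Lemma absorbed_glue_sequence u b v (z zs : nat -> K) :
  (b <= v)%O ->
  (forall n, [/\ (u <= z n)%O, (z n < zs n)%O, (zs n <= b)%O &
     forall t, (z n < t)%O -> (zs n <= t)%O]) ->
  (forall n, (z n <= z n.+1)%O) ->
  (forall t, (t < b)%O -> exists n, (t <= z n)%O) ->
  (forall n, absorbed u (z n)) -> absorbed b v -> absorbed u v.
Proof.
move=> bv zP zS zcof uz babs L clL Luv sL S0 fS0.
pose S := S0 `\` segment u v; pose L' := L `|` S.
have clL' : closed L'.
  by apply: closedU => //; apply: closed_finite; exact: finite_setD.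
have L'uv t : L' t -> ~ segment u v t by move=> [/Luv//|[]].
have -> : L `|` segment u v `|` S0 = L' `|` segment u v.
  apply/seteqP; split => t; rewrite /L' /S /=.
    by move=> [[?|?]|?]; [left; left|right|
      case: (pselect (segment u v t)) => ?; [right|left; right]].
  by move=> [[?|[? _]]|?]; [left; left|right|left; right].
have uz' n : (u <= z n)%O by have [] := zP n.
have zb n : (z n < b)%O by have [_ zzs zsb _] := zP n; exact: lt_le_trans zsb.
have zmono m n : (m <= n)%N -> (z m <= z n)%O.
  elim: n => [|n IH]; first by rewrite leqn0 => /eqP->.
  by rewrite leq_eqVlt ltnS => /predU1P[->//|/IH zmn]; exact: le_trans (zS n).
pose E n := L' `|` (segment u (z n) `|` segment b v).
(* Points up to [z n] and from [b] on stay; [[zs n, b]] collapses to [b]. *)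
pose r n t := if (t <= z n)%O then t else Order.max t b.
pose F := L' `|` segment u v.
have EF n : E n `<=` F.
  move=> t [?|[/andP[ut tz]|/andP[bt tv]]]; [by left|right|right]; apply/andP.
    by split => //; exact: le_trans tz (le_trans (ltW (zb n)) bv).
  by split => //; exact: le_trans (le_trans (uz' n) (ltW (zb n))) bt.
have rL n t : L' t -> r n t = t.
  move=> L't; rewrite /r; case: (leP t (z n)) => // zt; apply: max_l.
  rewrite leNgt; apply/negP => tb; apply: (L'uv t L't); apply/andP; split.
    exact: le_trans (uz' n) (ltW zt).
  exact: le_trans (ltW tb) bv.
have r_sep s t : (s < t)%O -> exists n, r n s <> r n t.
  move=> st; case: (ltP s b) => sb; last first.
    have bt := le_lt_trans sb st.
    exists 0%N; rewrite /r !leNgt (lt_le_trans (zb _) sb) (lt_trans (zb _) bt) /=.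
    by rewrite !max_l ?(ltW bt) // => sE; rewrite sE ltxx in st.
  have [n sn] := zcof s sb; case: (ltP t b) => tb.
    have [m tm] := zcof t tb; exists m; rewrite /r tm (le_trans (ltW st) tm) => sE.
    by rewrite sE ltxx in st.
  exists n; rewrite /r sn leNgt (lt_le_trans (zb n) tb) /= max_l // => sE.
  by rewrite sE ltxx in st.
apply: (@classR_retracts R K nat leq F E r).
- exact: order_hausdorff.
- exact: leq_well_order.
- by constructor; exact: 0%N.
- by apply: subclosed_compact cK _ => //; apply: closedU => //; exact: segment_closed.
- by move=> n; apply: closedU => //; apply: closedU; exact: segment_closed.
- exact: EF.
- move=> m n mn t [?|[/andP[ut tz]|?]]; [by left|right; left|by right; right].
  by apply/andP; split => //; apply: le_trans tz (zmono _ _ mn).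
(* The jump makes the two closed rays disjoint and covering, so the definitions on them may be
   chosen independently. *)
- move=> n; have [_ zzs zsb zsP] := zP n.
  apply: (@paste_continuous _ _ _ [set` `]-oo, z n]%O] [set` `[zs n, +oo[%O]
    _ id (fun t => Order.max t b)).
  + exact: lray_closed.
  + exact: rray_closed.
  + move=> t _; rewrite /setU /= !in_itv /= andbT.
    by case: (leP t (z n)) => [|/zsP]; [left|right].
  + by move=> t; exact: cvg_id.
  + by apply: max_fun_continuous => t; [exact: cvg_id|exact: cvg_cst].
  + by move=> t _; rewrite /= in_itv /= /r => ->.
  + move=> t _; rewrite /= in_itv /= andbT => zst.
    by rewrite /r leNgt (lt_le_trans zzs zst).
- move=> n t [L't|/andP[ut tv]]; first by rewrite rL //; left.
  right; rewrite /r; case: (leP t (z n)) => tz; first by left; apply/andP.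
  by right; apply/andP; rewrite le_max lexx orbT ge_max tv bv.
- move=> n t [/rL//|[/andP[ut tz]|/andP[bt tv]]]; first by rewrite /r tz.
  by rewrite /r leNgt (lt_le_trans (zb n) bt) /= max_l.
- move=> m n t mn Ft; rewrite /r; case: (leP t (z n)) => tn //.
  have tm := le_lt_trans (zmono _ _ mn) tn.
  by rewrite [X in if X then _ else _]leNgt lt_max tm /= leNgt tm /= -maxA maxxx.
- by move=> d s t /leq_no_limit.
- move=> s t Fs Ft rst; case: (ltgtP s t) => // /r_sep[n] //.
  by rewrite rst.
(* First [[u, z n]] is added to [L], then [[b, v]] to the result. *)
- move=> n; rewrite /E (_ : _ `|` _ = L `|` segment u (z n) `|` segment b v `|` S).
    apply: babs => //; last exact: finite_setD.
    + by apply: closedU => //; exact: segment_closed.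
    + move=> t [Lt|/andP[ut tz]] /andP[bt tv].
        apply: (Luv t Lt); apply/andP; split => //.
        exact: le_trans (le_trans (uz' n) (ltW (zb n))) bt.
      by have := lt_le_trans (zb n) (le_trans bt tz); rewrite ltxx.
    + apply: uz => // t Lt /andP[ut tz]; apply: (Luv t Lt); apply/andP; split => //.
      exact: le_trans tz (le_trans (ltW (zb n)) bv).
  by rewrite /L' setUA (setUAC L S) (setUAC _ S).
Qed.

End absorbing.

(** * Jumps in scattered orders, and gluing of segments *)

Definition has_jumps (disp : Order.disp_t) (K : orderType disp) : Prop :=
  forall s t : K, (s < t)%O -> exists c c',
    [/\ (s <= c)%O, (c < c')%O, (c' <= t)%O & forall u, (c < u)%O -> (c' <= u)%O].

Lemma has_jumps_dual (disp : Order.disp_t) (K : orderType disp) :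
  has_jumps K -> has_jumps (Order.dual K).
Proof.
move=> jK s t st; have [c [c' [tc cc' c's cP]]] := jK t s st.
exists c', c; split => // u uc'; rewrite leEdual leNgt; apply/negP => /cP c'u.
by have := lt_le_trans uc' c'u; rewrite ltxx.
Qed.

Lemma scattered_has_jumps (disp : Order.disp_t) (K : orderType disp) :
  scattered_order K -> has_jumps K.
Proof.
move=> sK s t st; apply: contrapT => nj; apply: sK.
(* This amounts to [max s a < min b t], which is monotone in both arguments on all of [K], as the
   embedding requires. Without a jump between [s] and [t] it is dense. *)
pose lt' a b := exists c e : K,
  [/\ (s <= c)%O, (a <= c)%O, (c < e)%O, (e <= b)%O & (e <= t)%O].
apply: (@rat_embedding _ _ lt' _ _ _ _ s t).
- by move=> a b [c [e [_ ac ce eb _]]]; exact: le_lt_trans ac (lt_le_trans ce eb).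
- by move=> a b u [c [e [sc ac ce eb et]]] bu; exists c, e; split => //;
    exact: le_trans bu.
- by move=> a b u ab [c [e [sc bc ce eu et]]]; exists c, e; split => //;
    exact: le_trans bc.
- move=> a b [c [e [sc ac ce eb et]]].
  have [m [cm me]] : exists m, (c < m)%O /\ (m < e)%O.
    apply: contrapT => nm; apply: nj; exists c, e; split => // u cu.
    by rewrite leNgt; apply/negP => ue; apply: nm; exists u.
  exists m; split; first by exists c, m; split => //; exact: le_trans (ltW me) et.
  by exists m, e; split => //; exact: le_trans sc (ltW cm).
- by exists s, t.
Qed.

Section dual_absorbing.
Variables (R : realType) (disp : Order.disp_t) (K : orderTopologicalType disp).
Implicit Types x y : K.

Lemma absorbed_dual x y :
  absorbed R (y : Order.dual K) (x : Order.dual K) <-> absorbed R x y.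
Proof.
have E : segment (y : Order.dual K) (x : Order.dual K) = segment x y.
  by apply/seteqP; split => t; rewrite /segment /= andbC.
by rewrite /absorbed E.
Qed.

Hypothesis cK : compact [set: K].

Lemma absorbed_limit_right x y :
  (forall t, (x < t)%O -> (t <= y)%O -> absorbed R t y) -> absorbed R x y.
Proof.
move=> IH; apply/absorbed_dual; apply: absorbed_limit => // t yt tx.
by apply/absorbed_dual; exact: IH.
Qed.

End dual_absorbing.

Lemma absorbed_glue_left (R : realType) (disp : Order.disp_t)
    (K : orderTopologicalType disp) (u b v : K) (w : nat -> K) :
  compact [set: K] -> has_jumps K -> (u < b)%O -> (b <= v)%O ->
  (forall n, (w n < b)%O) -> (forall t, (t < b)%O -> exists n, (t <= w n)%O) ->
  (forall t, (u <= t)%O -> (t < b)%O -> absorbed R u t) -> absorbed R b v ->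
  absorbed R u v.
Proof.
move=> cK jK ub bv wb wcof uab abv.
have /choice[j jP] s : exists cc' : K * K, (s < b)%O -> [/\ (s <= cc'.1)%O,
    (cc'.1 < cc'.2)%O, (cc'.2 <= b)%O & forall t, (cc'.1 < t)%O -> (cc'.2 <= t)%O].
  (* The pair [(b, b)] is a default value for [s] not below [b]. *)
  case: (ltP s b) => [sb|_]; last by exists (b, b).
  by have [c [c' ?]] := jK _ _ sb; exists (c, c').
(* Each new jump starts beyond the left end of the previous one and beyond [w m], so the left ends
   increase and are cofinal below [b]. *)
pose fix s n := if n is m.+1 then Order.max (j (s m)).1 (w m) else u.
have sb n : (s n < b)%O.
  elim: n => [|n IH] //=; rewrite gt_max wb andbT.
  by have [_ c1 c2 _] := jP _ IH; exact: lt_le_trans c2.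
have us n : (u <= s n)%O.
  elim: n => [|n IH] //=; rewrite le_max; apply/orP; left.
  by have [sc _ _ _] := jP _ (sb n); exact: le_trans sc.
apply: (@absorbed_glue_sequence R _ K cK u b v (fun n => (j (s n)).1)
  (fun n => (j (s n)).2)) => //.
- move=> n; have [sc ? ? ?] := jP _ (sb n); split => //.
  exact: le_trans sc.
- move=> n; have [sc _ _ _] := jP _ (sb n.+1); apply: le_trans sc.
  by rewrite /= le_max lexx.
- move=> t /wcof[n tw]; exists n.+1; have [sc _ _ _] := jP _ (sb n.+1).
  by apply: le_trans sc; rewrite /= le_max tw orbT.
- move=> n; have [sc c1 c2 _] := jP _ (sb n); apply: uab; first exact: le_trans sc.
  exact: lt_le_trans c2.
Qed.

Lemma absorbed_glue_right (R : realType) (disp : Order.disp_t)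
    (K : orderTopologicalType disp) (u b v : K) (w : nat -> K) :
  compact [set: K] -> has_jumps K -> (u <= b)%O -> (b < v)%O ->
  (forall n, (b < w n)%O) -> (forall t, (b < t)%O -> exists n, (w n <= t)%O) ->
  (forall t, (b < t)%O -> (t <= v)%O -> absorbed R t v) -> absorbed R u b ->
  absorbed R u v.
Proof.
move=> cK jK ub bv wb wcof tv aub; apply/absorbed_dual.
apply: (@absorbed_glue_left R _ (Order.dual K) v b u w) => //.
- exact: has_jumps_dual.
- by move=> t vt tb; apply/absorbed_dual; exact: tv.
- exact/absorbed_dual.
Qed.

(** * Cofinality and cutting P-points in ordered spaces *)

Lemma nbhs_left (disp : Order.disp_t) (K : orderTopologicalType disp)
    (u b : K) (U : set K) : (u < b)%O -> nbhs b U ->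
  exists2 l, (l < b)%O & forall t, (l < t)%O -> (t <= b)%O -> U t.
Proof.
rewrite itv_nbhsE => ub [[l r] [oi bi] iU].
have br t : (t <= b)%O -> (BRight t <= r)%O.
  move: bi; rewrite itv_boundlr => /andP[_ br] tb; apply: le_trans br.
  by rewrite bnd_simp.
have lb : (l <= BLeft b)%O by move: bi; rewrite itv_boundlr => /andP[].
case: l oi bi iU lb => [[] l|[]] oi bi iU lb.
- by move: oi; rewrite /itv_open_ends; case: (r) => [[] ?|[]].
- exists l; first by move: lb; rewrite bnd_simp.
  by move=> t lt tb; apply: iU; rewrite /= itv_boundlr br // andbT bnd_simp.
(* An interval unbounded to the left offers no left end; [u] takes its place. *)
- exists u => // t _ tb; apply: iU; rewrite /= itv_boundlr br // andbT.
- by move: lb.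
Qed.

Definition countable_left_cofinality (disp : Order.disp_t) (K : orderType disp)
    (b : K) : Prop :=
  exists w : nat -> K, (forall n, (w n < b)%O) /\
    forall t, (t < b)%O -> exists n, (t <= w n)%O.

(** Any sequence below [b] has a strict upper bound below [b]. Constant sequences give
    non-isolation; the left ends of countably many neighbourhoods give a common neighbourhood. *)
Lemma P_in_lray (disp : Order.disp_t) (K : orderTopologicalType disp) (u b : K) :
  (u < b)%O -> ~ countable_left_cofinality b -> P_in [set t | (t <= b)%O] b.
Proof.
move=> ub nb.
have above (w : nat -> K) : (forall n, (w n < b)%O) ->
    exists2 t, (t < b)%O & forall n, (w n < t)%O.
  move=> wb; apply: contrapT => nt; apply: nb; exists w; split => // t tb.
  apply: contrapT => ntw; apply: nt; exists t => // n.
  by rewrite ltNge; apply/negP => tw; apply: ntw; exists n.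
split=> [U bU|U bU].
  have [l lb lU] := nbhs_left ub bU.
  have [t tb lt] := above (fun _ => l) (fun _ => lb).
  exists t; split; [exact: lU (lt 0%N) (ltW tb)|exact: ltW|].
  by move=> tE; rewrite tE ltxx in tb.
have /choice[l lP] n : exists l, (l < b)%O /\
    forall t, (l < t)%O -> (t <= b)%O -> U n t.
  by have [l lb lU] := nbhs_left ub (bU n); exists l.
have [t tb lt] := above l (fun n => (lP n).1).
exists [set` `]t, +oo[%O].
  apply: open_nbhs_nbhs; split; first exact: rray_open.
  by rewrite /= in_itv /= andbT.
move=> x []; rewrite /= in_itv /= andbT => tx xb n _.
exact: (lP n).2 (lt_trans (lt n) tx) xb.
Qed.

Lemma cutting_P_point_cofinality (disp : Order.disp_t)
    (K : orderTopologicalType disp) (u b v : K) :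
  (u < b)%O -> (b < v)%O -> ~ countable_left_cofinality b ->
  ~ countable_left_cofinality (b : Order.dual K) -> cutting_P_point b.
Proof.
move=> ub bv nl nr; apply/cutting_P_pointP.
exists [set t | (t <= b)%O], [set t | (b <= t)%O]; split.
- split.
    rewrite (_ : [set _ | _] = [set` `]-oo, b]%O]); first exact: lray_closed.
    by apply/seteqP; split => t; rewrite /= in_itv.
  rewrite (_ : [set _ | _] = [set` `[b, +oo[%O]); first exact: rray_closed.
  by apply/seteqP; split => t; rewrite /= in_itv /= andbT.
- apply/seteqP; split => // t _.
  by case: (leP t b) => [|/ltW]; [left|right].
- apply/seteqP; split => [t [/= tb bt]|_ ->] /=; last by rewrite lexx.
  by apply/eqP; rewrite eq_le tb bt.
- exact: P_in_lray ub nl.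
- exact: (@P_in_lray _ (Order.dual K) v b bv nr).
Qed.

(** * Scattered compacta without cutting P-points *)

Section scattered.
Variables (R : realType) (disp : Order.disp_t) (K : orderTopologicalType disp).
Hypotheses (cK : compact [set: K]) (sK : scattered_order K)
  (ncut : forall p : K, ~ cutting_P_point p).
Implicit Types x y u v t : K.

(** Including all subsegments makes failure of the property pass to larger segments, as the
    embedding of the rationals demands. *)
Definition hereditarily_absorbed x y : Prop :=
  forall u v, (x <= u)%O -> (u <= v)%O -> (v <= y)%O -> absorbed R u v.
Local Notation H := hereditarily_absorbed.

Lemma hereditarily_absorbedS x y u v :
  (x <= u)%O -> (v <= y)%O -> H x y -> H u v.
Proof.
by move=> xu vy xy u' v' uu' u'v' v'v; apply: xy => //;
  [exact: le_trans uu'|exact: le_trans vy].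
Qed.

Lemma hereditarily_absorbed_limit x y :
  (forall t, (x <= t)%O -> (t < y)%O -> H x t) -> H x y.
Proof.
move=> IH u v xu uv; rewrite le_eqVlt => /predU1P[->|vy].
  apply: absorbed_limit => // t ut ty.
  exact: (IH t (le_trans xu ut) ty u t).
exact: (IH v (le_trans xu uv) vy u v).
Qed.

Lemma hereditarily_absorbed_limit_right x y :
  (forall t, (x < t)%O -> (t <= y)%O -> H t y) -> H x y.
Proof.
move=> IH u v; rewrite le_eqVlt => /predU1P[<-|xu] uv vy.
  apply: absorbed_limit_right => // t xt tv.
  exact: (IH t xt (le_trans tv vy) t v).
exact: (IH u xu (le_trans uv vy) u v).
Qed.

Lemma hereditarily_absorbed_glue x b y : H x b -> H b y -> H x y.
Proof.
move=> xb bY u v xu uv vy.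
case: (leP v b) => vb; first exact: xb.
case: (leP b u) => bu; first exact: bY.
have jK := scattered_has_jumps sK.
have [[w [wb wcof]]|nl] := pselect (countable_left_cofinality b).
  apply: (absorbed_glue_left cK jK bu (ltW vb) wb wcof).
    by move=> t ut tb; apply: xb => //; exact: ltW.
  by apply: bY => //; exact: ltW.
have [[w [wb wcof]]|nr] :=
    pselect (countable_left_cofinality (b : Order.dual K)).
  apply: (absorbed_glue_right cK jK (ltW bu) vb wb wcof).
    by move=> t bt tv; apply: bY => //; exact: ltW.
  by apply: xb => //; exact: ltW.
(* Neither side of [b] has countable cofinality, so [b] would be a cutting P-point. *)
by have := cutting_P_point_cofinality bu vb nl nr => /ncut.
Qed.

Lemma hereditarily_absorbed_refl x : H x x.
Proof.
by apply: hereditarily_absorbed_limit => t xt /(le_lt_trans xt); rewrite ltxx.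
Qed.

(** Let [s] be the supremum of the [t] with [H x t], and [s'] the infimum of the [t >= s] with
    [H t y]; the limit lemmas give [H x s] and [H s' y]. Any point strictly between [s] and [s']
    will do; if there is none, gluing at [s] and [s'] yields [H x y]. *)
Lemma not_hereditarily_absorbed_dense x y : (x < y)%O -> ~ H x y ->
  exists t, [/\ (x < t)%O, (t < y)%O, ~ H x t & ~ H t y].
Proof.
move=> xy nxy.
have [|s [sP smin]] := compact_sup cK (S := [set t | (x <= t <= y)%O /\ H x t]).
  by exists x; rewrite /= lexx ltW //; split => //; exact: hereditarily_absorbed_refl.
have xs : (x <= s)%O.
  by apply: sP; rewrite /= lexx ltW //; split => //; exact: hereditarily_absorbed_refl.
have sy : (s <= y)%O by apply: smin => t [/andP[]].
have Hxs : H x s.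
  apply: hereditarily_absorbed_limit => t xt ts; apply: contrapT => nt.
  move: (ts); rewrite ltNge => /negP; apply; apply: smin => r [/andP[xr ry] Hxr].
  rewrite leNgt; apply/negP => tr; apply: nt.
  exact: hereditarily_absorbedS (lexx x) (ltW tr) Hxr.
have [|s' [s'P s'max]] := compact_inf (S := [set t | (s <= t <= y)%O /\ H t y]) cK.
  by exists y; rewrite /= lexx sy; split => //; exact: hereditarily_absorbed_refl.
have s'y : (s' <= y)%O.
  by apply: s'P; rewrite /= lexx sy; split => //; exact: hereditarily_absorbed_refl.
have ss' : (s <= s')%O by apply: s'max => t [/andP[]].
have Hs'y : H s' y.
  apply: hereditarily_absorbed_limit_right => t s't ty; apply: contrapT => nt.
  move: (s't); rewrite ltNge => /negP; apply; apply: s'max => r [/andP[sr ry] Hry].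
  rewrite leNgt; apply/negP => rt; apply: nt.
  exact: hereditarily_absorbedS (ltW rt) (lexx y) Hry.
have [[t [st ts']]|nt] := pselect (exists t, (s < t)%O /\ (t < s')%O).
  have xt := le_lt_trans xs st; have ty := lt_le_trans ts' s'y.
  exists t; split => // [Hxt|Hty].
    have : (t <= s)%O by apply: sP; rewrite /= !ltW.
    by rewrite leNgt st.
  have : (s' <= t)%O by apply: s'P; rewrite /= !ltW.
  by rewrite leNgt ts'.
case: nxy; apply: hereditarily_absorbed_glue Hs'y.
apply: hereditarily_absorbed_glue Hxs _.
apply: hereditarily_absorbed_limit => t st ts'.
have -> : t = s; last exact: hereditarily_absorbed_refl.
apply/eqP; rewrite eq_le st andbT leNgt; apply/negP => st'.
by apply: nt; exists t.
Qed.

Lemma hereditarily_absorbed_all x y : (x < y)%O -> H x y.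
Proof.
move=> xy; apply: contrapT => nxy; apply: sK.
apply: (@rat_embedding _ _ (fun a b => (a < b)%O /\ ~ H a b) _ _ _ _ x y) => //.
- by move=> a b [].
- move=> a b c [ab nab] bc; split; first exact: lt_le_trans bc.
  by move=> ac; apply: nab; exact: hereditarily_absorbedS ac.
- move=> a b c ab [bc nbc]; split; first exact: le_lt_trans bc.
  by move=> ac; apply: nbc; exact: hereditarily_absorbedS ac.
- move=> a b [ab nab].
  by have [c [? ? ? ?]] := not_hereditarily_absorbed_dense ab nab; exists c.
Qed.

Lemma scattered_classR : classR R K.
Proof.
(* The segment from the minimum to the maximum of [K] will be absorbed by the empty set, to which
   only finite sets have to be added here. *)
have stable0 : stable R (set0 : set K).
  by move=> S fS; rewrite set0U; apply: classR_finite => //; exact: order_hausdorff.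
have full : classR R [set: K].
  have [[x0 _]|K0] := pselect ([set: K] !=set0); last first.
    have := stable0 set0 (finite_set0 _); rewrite setU0 (_ : set0 = setT) //.
    by apply/seteqP; split => // x _; case: K0; exists x.
  have [m [mP _]] := compact_inf cK (ex_intro _ x0 Logic.I : [set: K] !=set0).
  have [M [MP _]] := compact_sup cK (ex_intro _ x0 Logic.I : [set: K] !=set0).
  have mM : absorbed R m M.
    have : (m <= M)%O by exact: mP.
    rewrite le_eqVlt => /predU1P[->|mM]; first exact: absorbed_refl.
    by apply: (hereditarily_absorbed_all mM) => //; exact: ltW.
  have := mM set0 closed0 (fun _ => False_ind _) stable0 set0 (finite_set0 _).
  rewrite set0U setU0 (_ : segment m M = setT) //.
  by apply/seteqP; split => // t _; apply/andP; rewrite mP // MP.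
apply: classR_homeomorphic full.
exists (fun x => SigSub (mem_set (Logic.I : [set: K] x))), set_val; split => //.
- by apply: continuous_set_type => x; exact: cvg_id.
- exact: set_val_continuous.
- by move=> x; apply: set_val_inj.
Qed.

End scattered.

Theorem theorem5p3 (R : realType) (d : Order.disp_t)
    (K : orderTopologicalType d)
    (K_compact : compact [set: K]) (K_scattered : scattered_order K) :
  classR R K <-> ~ exists p : K, cutting_P_point p.
Proof.
split=> [/classR_no_cutting_P_point[_ _ nK] [p /nK]//|nK].
by apply: scattered_classR => // p cp; apply: nK; exists p.
Qed.
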